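(* Let $\mathcal{G}$ be a $d$-regular Borel pmp graph on a standard probability space $(X,\mu)$. Then for any $\mu$-measurable $\mathcal{G}$-independent set $S\subseteq X$, $$\mu(S)\le\frac{-m(T_{\mathcal{G}})}{d-m(T_{\mathcal{G}})}=1-\frac{d}{M(L_{\mathcal{G}})}.$$ In particular, $i_\mu(\mathcal{G})\le\frac{-m(T_{\mathcal{G}})}{d-m(T_{\mathcal{G}})}$.
   Context: A Borel graph on $X$ is a simple undirected graph with Borel edge set; $d$-regular means all degrees equal $d$ (up to null sets). pmp: every partial Borel bijection of $X$ whose graph is contained in the connectedness relation of $\mathcal{G}$ preserves $\mu$. $T_{\mathcal{G}}f(x)=\sum_{y\sim x}f(y)$ and $L_{\mathcal{G}}f(x)=\deg(x)f(x)-\sum_{y\sim x}f(y)$ on $L^2(X,\mu)$. For a bounded self-adjoint $T$, $M(T)=\sup_{f\ne0}\langle Tf,f\rangle/\langle f,f\rangle$, $m(T)=\inf_{f\ne0}\langle Tf,f\rangle/\langle f,f\rangle$. A set is $\mathcal{G}$-independent if no two of its points are adjacent; $i_\mu(\mathcal{G})=\sup\{\mu(A): A \text{ measurable and } \mathcal{G}\text{-independent}\}$. *)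

(* Defs.v *)
From HB Require Import structures.
From mathcomp Require Import all_boot all_order all_algebra.
From mathcomp Require Import all_classical all_reals all_analysis.
From Stdlib Require Import Relations.
Set Implicit Arguments. Unset Strict Implicit. Unset Printing Implicit Defensive.
Import Order.TTheory GRing.Theory Num.Theory.
Import numFieldNormedType.Exports.
Local Open Scope classical_set_scope.
Local Open Scope ring_scope.

Section Defs.
Context (R : realType) (dX : measure_display) (X : measurableType dX).

(* Standard Borel space: Borel isomorphic to a Borel subset of the reals
   (Kuratowski): a measurable injection into R mapping Borel sets to Borel sets. *)
Definition standard_borel : Prop :=
  exists f : X -> R, measurable_fun setT f /\ injective f /\
    (forall A : set X, measurable A -> measurable (f @` A)).

Definition borel_graph (E : X -> X -> Prop) : Prop :=
  (forall x y, E x y -> E y x) /\ (forall x, ~ E x x) /\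
  measurable [set xy : X * X | E xy.1 xy.2].

Definition nbhd (E : X -> X -> Prop) (x : X) : set X := [set y | E x y].

Definition deg (E : X -> X -> Prop) (x : X) : R := \sum_(y \in nbhd E x) (1 : R).

Definition regular (mu : set X -> \bar R) (E : X -> X -> Prop) (d : nat) : Prop :=
  {ae mu, forall x, (nbhd E x #= `I_d)%card}.

Definition conn (E : X -> X -> Prop) : X -> X -> Prop := clos_refl_trans X E.

(* pmp: every partial Borel bijection phi : A -> phi(A) (A Borel, phi Borel,
   injective, with Borel inverse, i.e. images of Borel subsets are Borel)
   whose graph lies in the connectedness relation preserves mu. *)
Definition pmp (mu : set X -> \bar R) (E : X -> X -> Prop) : Prop :=
  forall (A : set X) (phi : X -> X),
    measurable A -> measurable_fun A phi -> set_inj A phi ->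
    (forall C, measurable C -> C `<=` A -> measurable (phi @` C)) ->
    (forall x, A x -> conn E x (phi x)) ->
    forall C, measurable C -> C `<=` A -> mu (phi @` C) = mu C.

Definition adjT (E : X -> X -> Prop) (f : X -> R) : X -> R :=
  fun x => \sum_(y \in nbhd E x) f y.

Definition lapL (E : X -> X -> Prop) (f : X -> R) : X -> R :=
  fun x => deg E x * f x - adjT E f x.

Definition L2 (mu : {measure set X -> \bar R}) (f : X -> R) : Prop :=
  measurable_fun setT f /\ mu.-integrable setT (fun x => (f x ^+ 2)%:E).

Definition rayleigh (mu : {measure set X -> \bar R}) (A : (X -> R) -> (X -> R))
  : set R :=
  [set r | exists f : X -> R, L2 mu f /\
     exists q : R, 0 < q /\
       (\int[mu]_x ((f x ^+ 2)%:E) = q%:E)%E /\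
       (\int[mu]_x ((A f x * f x)%:E) = (r * q)%:E)%E].

Definition Mop (mu : {measure set X -> \bar R}) A : R := sup (rayleigh mu A).
Definition mop (mu : {measure set X -> \bar R}) A : R := inf (rayleigh mu A).

Definition independent (E : X -> X -> Prop) (S : set X) : Prop :=
  forall x y, S x -> S y -> ~ E x y.

Definition symdiff (S B : set X) : set X := (S `\` B) `|` (B `\` S).

(* i_mu(G): sup of the (completed) measures of mu-measurable independent sets;
   a mu-measurable S has measure mu B for any Borel B with S symdiff B null. *)
Definition indep_number (mu : {measure set X -> \bar R}) (E : X -> X -> Prop)
  : \bar R :=
  ereal_sup [set v | exists S B, independent E S /\ measurable B /\
                       mu.-negligible (symdiff S B) /\ v = mu B].

End Defs.

(* Main.v *)
Require Import Defs.
From HB Require Import structures.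
From mathcomp Require Import all_boot all_order all_algebra.
From mathcomp Require Import all_classical all_reals all_analysis.
From mathcomp Require Import measurable_realfun ring lra.
From Stdlib Require Import Relations.
Set Implicit Arguments. Unset Strict Implicit. Unset Printing Implicit Defensive.
Import Order.TTheory GRing.Theory Num.Theory.
Import numFieldNormedType.Exports.
Local Open Scope classical_set_scope.
Local Open Scope ring_scope.

(* Lusin-Novikov up to null sets: projections of Borel sets are measurable by
   Choquet capacitability, so the d neighbours of almost every point are listed
   by Borel maps phi_0, ..., phi_(d-1). Preservation of the measure is first used
   to see that each phi_i pulls null sets back to null sets. The exceptional null
   set may contain points of uncountable degree, so that phi_i is far from
   injective there; if a set of positive measure were sent into a null set, its
   fibres would carry atomless conditional measures, which a partial injection
   along the fibres could contract. Each phi_i is then piecewise invertible with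
   some phi_j as inverse, which gives the mass transport identity
   sum_i int g(phi_i x) = d int g. Hence T is bounded and L = d - T, and Hoffman's
   argument applied to 1_S - mu(S) yields the bound; m(T) <= 0 because the
   neighbours of a point are separated from it by a rational interval, which
   produces an independent set of positive measure. *)

(** The obstacle is that regularity holds only almost everywhere: a point with [d] neighbours may be
    adjacent to points about which nothing is known. The relation [phi_j (phi_i x) = x], on which
    mass transport rests, needs every iterated image of [x] to be good, hence maps that pull null
    sets back to null sets. But [pmp] speaks of injections only, and the injective pieces would come
    from that very relation; [null_fibre] breaks this circle. The constants of the bound come from
    the functions [1_S - c]. With [b = mu S], independence removes the quadratic term in [1_S], so
    the form of [T] is [d (c^2 - 2 c b)], against a squared norm [b - 2 c b + c^2]. At [c = b] the
    quotient is [- d b / (1 - b)], and [m <= - d b / (1 - b)] rearranges to the claim; [c = 0] gives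
    [m <= 0], which makes the denominator [d - m] positive. *)

(** * Outer measure and capacitability *)

Section Hull.
Context (R : realType) (d : measure_display) (T : measurableType d).
Variable mu : probability T R.

Lemma prob_fin (A : set T) : measurable A -> exists r : R, (0 <= r) /\ mu A = r%:E.
Proof.
move=> mA; exists (fine (mu A)); split; first exact: fine_ge0.
by rewrite fineK// fin_num_measure.
Qed.

(** The intersection of a minimising sequence of measurable supersets attains the outer measure. *)
Lemma measurable_hull_exists (A : set T) : exists H, [/\ measurable H, A `<=` H &
  forall H', measurable H' -> A `<=` H' -> (mu H <= mu H')%E].
Proof.
pose S := [set v | exists H, [/\ measurable H, A `<=` H & v = mu H]].
have S0 : S != set0 by apply/set0P; exists (mu setT), setT; split.
have [u Su cu] := ereal_inf_seq S0.
have /choice [h hP] := Su.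
have mh n : measurable (h n) by have [] := hP n.
exists (\bigcap_n h n); split.
- exact: bigcapT_measurable.
- by move=> x Ax n _; have [_ + _] := hP n; apply.
- move=> H' mH' AH'.
  apply: (@le_trans _ _ (ereal_inf S)); last by apply: ereal_inf_lbound; exists H'.
  rewrite -(cvg_lim _ cu)//; apply: lime_ge.
    by apply/cvg_ex; eexists; exact: cu.
  apply: nearW => n; have [_ _ ->] := hP n.
  apply: le_measure; rewrite ?inE//; first exact: bigcapT_measurable.
  exact: bigcap_inf.
Qed.

Definition hull (A : set T) := projT1 (cid (measurable_hull_exists A)).

Lemma measurable_hull A : measurable (hull A).
Proof. by rewrite /hull; case: cid => H /= []. Qed.

Lemma sub_hull A : A `<=` hull A.
Proof. by rewrite /hull; case: cid => H /= []. Qed.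

Lemma hull_min A H : measurable H -> A `<=` H -> (mu (hull A) <= mu H)%E.
Proof. by rewrite /hull; case: cid => H' /= [_ _]; apply. Qed.

(** Hulls of an increasing sequence need not increase. The intersections of all later hulls do, and
    they still cover the sets without exceeding the measure of their hulls, so continuity from below
    applies to them. *)
Lemma hull_bigcup (A : nat -> set T) (c : \bar R) :
  (forall m n, (m <= n)%N -> A m `<=` A n) ->
  (c < mu (hull (\bigcup_n A n)))%E -> exists n, (c < mu (hull (A n)))%E.
Proof.
move=> ndA cA; apply: contrapT => /forallNP nc.
have {}nc n : (mu (hull (A n)) <= c)%E by rewrite leNgt; apply/negP/nc.
pose H m := \bigcap_(l in [set l | (m <= l)%N]) hull (A l).
have mH m : measurable (H m).
  by apply: bigcap_measurableType => k _; exact: measurable_hull.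
have AH m : A m `<=` H m.
  by move=> x Ax l /= ml; apply: sub_hull; exact: (ndA m).
have cvgH : mu \o H @ \oo --> mu (\bigcup_n H n).
  apply: nondecreasing_cvg_mu => //; first exact: bigcupT_measurable.
  move=> m n mn; apply/subsetPset => x Hx l /= nl.
  by apply: Hx => /=; exact: leq_trans nl.
have : (mu (hull (\bigcup_n A n)) <= c)%E.
  apply: (@le_trans _ _ (mu (\bigcup_n H n))).
    apply: hull_min; first exact: bigcupT_measurable.
    by apply: subset_bigcup => n _; exact: AH.
  rewrite -(cvg_lim _ cvgH)//; apply: lime_le.
    by apply/cvg_ex; eexists; exact: cvgH.
  apply: nearW => n /=; apply: le_trans (nc n).
  apply: le_measure; rewrite ?inE//; first exact: measurable_hull.
  by move=> x /(_ n); apply => /=.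
by rewrite leNgt cA.
Qed.

End Hull.

(** Suslin schemes are indexed by whole digit sequences, each set reading only finitely many digits.
    How many may depend on [n] freely, so schemes can be recoded without renumbering prefixes. *)
Definition finite_dep U (Q : nat -> (nat -> nat) -> U) :=
  forall n, exists b, forall s s' : nat -> nat,
    (forall j, (j < b)%N -> s j = s' j) -> Q n s = Q n s'.

Lemma finite_depP U (Q : nat -> (nat -> nat) -> U) : finite_dep Q ->
  exists b : nat -> nat, forall n (s s' : nat -> nat),
    (forall j, (j < b n)%N -> s j = s' j) -> Q n s = Q n s'.
Proof. by move=> dQ; have [b bP] := choice dQ; exists b. Qed.

Section Suslin.
Context (R : realType) (d : measure_display) (T : measurableType d).
Variable mu : probability T R.
Variable A : nat -> (nat -> nat) -> set T.
Hypothesis mA : forall n s, measurable (A n s).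
Hypothesis dA : finite_dep A.

Let SA := [set x | exists s, forall n, A n s x].

(* Choquet's capacitability argument: the outer measure is continuous along
   increasing unions, so the digits can be bounded one after the other. *)
Lemma suslin_inner (c : \bar R) : (c < mu (hull mu SA))%E ->
  exists C, [/\ measurable C, C `<=` SA & (c <= mu C)%E].
Proof.
move=> cSA; have [b bP] := finite_depP dA.
(* Here the first digits are capped by [m]. Letting the cap on the next digit grow gives an
   increasing union, so [hull_bigcup] supplies a finite cap that keeps the outer measure above
   [c]. *)
pose SB (m : seq nat) := [set x | exists s : nat -> nat,
  (forall j, (j < size m)%N -> (s j <= nth 0 m j)%N) /\ forall n, A n s x].
have step m : exists k, (c < mu (hull mu (SB m)))%E ->
    (c < mu (hull mu (SB (rcons m k))))%E.
  have [cm|] := pselect (c < mu (hull mu (SB m)))%E; last by exists 0%N.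
  have : SB m = \bigcup_k SB (rcons m k).
    rewrite eqEsubset; split => [x [s [sm sA]]|x [k _ [s [sm sA]]]].
      exists (s (size m)) => //; exists s; split=> // j.
      rewrite size_rcons ltnS leq_eqVlt nth_rcons => /predU1P[->|jm].
        by rewrite ltnn eqxx.
      by rewrite jm sm.
    exists s; split=> // j jm; have := sm j; rewrite size_rcons nth_rcons jm.
    by apply; rewrite ltnW.
  move=> E; have {}cm : (c < mu (hull mu (\bigcup_k SB (rcons m k))))%E by rewrite -E.
  have [k l kl x [s [sm sA]]|k ck] := hull_bigcup _ cm; last by exists k.
  exists s; split => // j jm; apply: leq_trans (sm j _) _.
    by rewrite !size_rcons in jm *.
  by rewrite !nth_rcons; case: ltnP => // _; case: eqP.
have [g gP] := choice step.
pose st := fix st k := if k is k'.+1 then rcons (st k') (g (st k')) else [::].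
pose M j := g (st j).
have sst k : size (st k) = k by elim: k => //= k IH; rewrite size_rcons IH.
have nst k j : (j < k)%N -> nth 0 (st k) j = M j.
  elim: k => // k IH; rewrite ltnS leq_eqVlt /= nth_rcons sst.
  by case/predU1P => [->|jk]; rewrite ?ltnn ?eqxx// jk IH.
have cst' k : (c < mu (hull mu (SB (st k))))%E.
  elim: k => [|k IH]; last exact: gP.
  suff -> : SB (st 0%N) = SA by [].
  by rewrite eqEsubset; split => [x [s [_ sA]]|x [s sA]]; exists s.
(* Only conditions decided by the first [k] digits are kept, so [C k] is a countable union of
   measurable sets. *)
pose C k := [set x | exists s : nat -> nat, (forall j, (j < k)%N -> (s j <= M j)%N) /\
  forall n, (n < k)%N -> (b n <= k)%N -> A n s x].
have mC k : measurable (C k).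
  have -> : C k = \bigcup_(s in [set s : seq nat |
      forall j, (j < k)%N -> (nth 0 s j <= M j)%N])
      \bigcap_(n in [set n | (n < k)%N /\ (b n <= k)%N]) A n (nth 0 s).
    rewrite eqEsubset; split => [x [s [sM sA]]|x [s /= sM sA]]; last first.
      by exists (nth 0 s); split=> // n nk bnk; apply: sA.
    have ns j : (j < k)%N -> nth 0 (mkseq s k) j = s j.
      by move=> jk; rewrite nth_mkseq.
    exists (mkseq s k) => [j jk /=|n /= [nk bnk]]; first by rewrite ns// sM.
    rewrite (bP n _ s); first exact: sA.
    by move=> j jb; rewrite ns// (leq_trans jb).
  rewrite bigcup_mkcond; apply: countable_bigcupT_measurable => // s.
  by case: ifP => // _; apply: bigcap_measurableType.
have niC : nonincreasing_seq C.
  move=> k l kl; apply/subsetPset => x [s [sM sA]]; exists s; split.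
    by move=> j jk; apply/sM/(leq_trans jk).
  by move=> n nk bk; apply: sA; [exact: leq_trans kl|exact: leq_trans kl].
exists (\bigcap_k C k); split.
- exact: bigcapT_measurable.
- move=> x Cx.
  (* Koenig's lemma: a good prefix extends to witnesses at every level. The cap leaves finitely many
     next digits; if each failed at some level, the largest of these levels would contradict
     goodness of [t]. *)
  pose good (t : seq nat) := forall k, (size t <= k)%N -> exists s : nat -> nat,
    [/\ forall j, (j < size t)%N -> s j = nth 0 t j,
        forall j, (j < k)%N -> (s j <= M j)%N &
        forall n, (n < k)%N -> (b n <= k)%N -> A n s x].
  have good0 : good [::].
    by move=> k _; have [s [sM sA]] := Cx k I; exists s; split.
  have goodS t : exists m, good t -> good (rcons t m).
    have [gt|] := pselect (good t); last by exists 0%N.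
    suff [m] : exists m, good (rcons t m) by exists m.
    apply: contrapT => /forallNP ng.
    have /choice [K KP] : forall m, exists k, (size t < k)%N /\ ~ exists s : nat -> nat,
      [/\ forall j, (j < (size t).+1)%N -> s j = nth 0 (rcons t m) j,
        forall j, (j < k)%N -> (s j <= M j)%N &
        forall n, (n < k)%N -> (b n <= k)%N -> A n s x].
      move=> m; have /existsNP[k /not_implyP[]] := ng m.
      by rewrite size_rcons => tk ns; exists k.
    pose k := (\max_(m < (M (size t)).+1) K m)%N.
    have Kk m : (m < (M (size t)).+1)%N -> (K m <= k)%N.
      by move=> mM; exact: (leq_bigmax (Ordinal mM)).
    have tk : (size t < k)%N.
      by apply: leq_trans (Kk 0%N _) => //; have [] := KP 0%N.
    have [s [st1 sM sA]] := gt k (ltnW tk).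
    have sMt : (s (size t) < (M (size t)).+1)%N by rewrite ltnS sM.
    have [_] := KP (s (size t)); apply; exists s; split.
    + move=> j; rewrite ltnS leq_eqVlt nth_rcons => /predU1P[->|jt].
        by rewrite ltnn eqxx.
      by rewrite jt st1.
    + by move=> j jk; apply: sM; apply: leq_trans (Kk _ sMt).
    + move=> n nK bK; apply: sA; first exact: leq_trans (Kk _ sMt).
      exact: leq_trans (Kk _ sMt).
  have [e eP] := choice goodS.
  pose br := fix br k := if k is k'.+1 then rcons (br k') (e (br k')) else [::].
  pose s j := e (br j).
  have sbr k : size (br k) = k by elim: k => //= k IH; rewrite size_rcons IH.
  have nbr k j : (j < k)%N -> nth 0 (br k) j = s j.
    elim: k => // k IH; rewrite ltnS leq_eqVlt /= nth_rcons sbr.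
    by case/predU1P => [->|jk]; rewrite ?ltnn ?eqxx// jk IH.
  have gbr k : good (br k) by elim: k => // k IH; exact: eP.
  exists s => n; pose k := maxn n.+1 (b n).
  have [|s' [s'1 _ s'A]] := gbr k k; first by rewrite sbr.
  rewrite (bP n s s'); first by apply: s'A; rewrite leq_max leqnn ?orbT.
  move=> j jb; have jk : (j < k)%N by rewrite (leq_trans jb)// leq_max leqnn orbT.
  by rewrite s'1 ?sbr// nbr.
- have cvgC : mu \o C @ \oo --> mu (\bigcap_k C k).
    apply: nonincreasing_cvg_mu => //; last exact: bigcapT_measurable.
    by rewrite -ge0_fin_numE// fin_num_measure.
  rewrite -(cvg_lim _ cvgC)//; apply: lime_ge.
    by apply/cvg_ex; eexists; exact: cvgC.
  apply: nearW => k /=; apply: (le_trans (ltW (cst' k))).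
  apply: hull_min => // x [s [sM sA]]; exists s; split=> // j jk.
  by have := sM j; rewrite sst nst//; apply.
Qed.

(** Inner approximations within [1/(n+1)] of the outer measure exhaust the hull up to a null set. *)
Lemma suslin_measurable : exists P N, [/\ measurable P, measurable N, mu N = 0,
  P `<=` SA & SA `<=` P `|` N].
Proof.
have [r [r0 rE]] := prob_fin mu (measurable_hull mu SA).
have /choice[C CP] : forall n : nat, exists C, [/\ measurable C, C `<=` SA &
    ((r - n.+1%:R^-1)%:E <= mu C)%E].
  move=> n; apply: suslin_inner; rewrite rE lte_fin ltrBlDr ltrDl.
  by rewrite invr_gt0.
pose P := \bigcup_n C n.
have mP : measurable P by apply: bigcupT_measurable => n; have [] := CP n.
have PSA : P `<=` SA by move=> x [n _]; have [_ + _] := CP n; apply.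
have PH : P `<=` hull mu SA by apply: (subset_trans PSA); exact: sub_hull.
exists P, (hull mu SA `\` P); split => //.
- by apply: measurableD => //; exact: measurable_hull.
- have [p [p0 pE]] := prob_fin mu mP.
  have E : mu (hull mu SA `\` P) = (r - p)%:E.
    have <- : (mu (hull mu SA) - mu P)%E = (r - p)%:E by rewrite rE pE.
    rewrite measureD//; [by rewrite setIidr|exact: measurable_hull|].
    by rewrite -ge0_fin_numE// fin_num_measure//; exact: measurable_hull.
  have : (0 <= mu (hull mu SA `\` P))%E by exact: measure_ge0.
  rewrite E lee_fin subr_ge0 => pr; congr (_%:E); apply/eqP; rewrite subr_eq0.
  rewrite eq_le pr andbT leNgt; apply/negP => rp.
  have d0 : 0 < r - p by rewrite subr_gt0.
  have [n nP] : exists n : nat, n.+1%:R^-1 < r - p.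
    have [n] := ltr_add_invr d0; rewrite add0r => ?; by exists n.
  have [_ _ rC] := CP n.
  have : (mu (C n) <= mu P)%E.
    apply: le_measure; rewrite ?inE//; first by have [] := CP n.
    by move=> x Cx; exists n.
  by move=> /(le_trans rC); rewrite pE lee_fin lerBlDl -lerBlDr leNgt nP.
- move=> x SAx; have [|] := pselect (P x); [by left|right; split=> //].
  exact: sub_hull.
Qed.

End Suslin.

(** * Suslin sets in a product with the line, and their projections *)

Section SuslinProduct.
Context (R : realType) (d : measure_display) (T : measurableType d).

(** The second factors are closed so that compactness can eliminate the real coordinate once it is
    confined to a bounded interval. *)
Definition suslin_set (D : set (T * R)) :=
  exists Q : nat -> (nat -> nat) -> set T * set R,
    [/\ forall n s, measurable (Q n s).1 /\ closed (Q n s).2, finite_dep Q &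
        D = [set z | exists s, forall n, (Q n s).1 z.1 /\ (Q n s).2 z.2]].

Lemma suslin_rectangle (A : set T) (K : set R) :
  measurable A -> closed K -> suslin_set (A `*` K).
Proof.
move=> mA cK; exists (fun _ _ => (A, K)); split => //.
  by move=> n; exists 0%N.
rewrite eqEsubset; split => [[x t] [Ax Kt]|[x t] [s]]; last by move=> /(_ 0%N).
by exists (fun=> 0%N).
Qed.

(** The first digit names a member of the union and the remaining digits are its witness. *)
Lemma suslin_bigcup (D : nat -> set (T * R)) :
  (forall i, suslin_set (D i)) -> suslin_set (\bigcup_i D i).
Proof.
move=> /choice[Q QP].
pose Q' m (s : nat -> nat) := if @unpickle (nat * nat)%type m is Some (i, n) then
  (if s 0%N == i then Q i n (fun j => s j.+1) else (setT, setT)) else (setT, setT).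
exists Q'; split.
- move=> m s; rewrite /Q'; case: unpickle => [[i n]|]; last first.
    by split; [exact: measurableT|exact: closedT].
  case: eqP => _; last by split; [exact: measurableT|exact: closedT].
  by have [+ _ _] := QP i; apply.
- move=> m; rewrite /Q'; case: unpickle => [[i n]|]; last by exists 0%N.
  have [_ /(_ n)[b bP] _] := QP i; exists b.+1 => s s' ss'.
  by rewrite ss'//; case: eqP => // _; apply: bP => j jb; exact: ss'.
- rewrite eqEsubset; split => [z [i _]|z [s sQ]].
    have [_ _ ->] := QP i; case=> s sQ.
    exists (fun j => if j is j'.+1 then s j' else i) => m; rewrite /Q'.
    case: unpickle => [[k n]|//]; case: eqP => // <-; exact: sQ.
  exists (s 0%N) => //; have [_ _ ->] := QP (s 0%N).
  exists (fun j => s j.+1) => n; have := sQ (pickle (s 0%N, n)).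
  by rewrite /Q' pickleK eqxx.
Qed.

(** One sequence stores a witness for every [i], through the coding of pairs of integers. Reading
    [b] digits of one witness takes a longer but still finite prefix, which [finite_dep] permits. *)
Lemma suslin_bigcap (D : nat -> set (T * R)) :
  (forall i, suslin_set (D i)) -> suslin_set (\bigcap_i D i).
Proof.
move=> /choice[Q QP].
pose part (s : nat -> nat) (i j : nat) := s (pickle (i, j)).
pose Q' m (s : nat -> nat) := if @unpickle (nat * nat)%type m is Some (i, n) then
  Q i n (part s i) else (setT, setT).
exists Q'; split.
- move=> m s; rewrite /Q'; case: unpickle => [[i n]|]; last first.
    by split; [exact: measurableT|exact: closedT].
  by have [+ _ _] := QP i; apply.
- move=> m; rewrite /Q'; case: unpickle => [[i n]|]; last by exists 0%N.
  have [_ /(_ n)[b bP] _] := QP i.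
  exists (\max_(j < b) (pickle (i, nat_of_ord j)).+1)%N => s s' ss'.
  apply: bP => j jb; apply: ss'.
  exact: (leq_bigmax (F := fun j : 'I_b => (pickle (i, nat_of_ord j)).+1) (Ordinal jb)).
- rewrite eqEsubset; split => [z Dz|z [s sQ] i _]; last first.
    have [_ _ ->] := QP i; exists (part s i) => n.
    by have := sQ (pickle (i, n)); rewrite /Q' pickleK.
  have /choice[s sP] : forall i, exists s, forall n, (Q i n s).1 z.1 /\ (Q i n s).2 z.2.
    by move=> i; have := Dz i I; have [_ _ ->] := QP i.
  exists (fun m => if @unpickle (nat * nat)%type m is Some (i, j) then s i j else 0%N).
  move=> m; rewrite /Q'; case: unpickle => [[i n]|//].
  rewrite (_ : part _ i = s i); first exact: sP.
  by apply/funext => j; rewrite /part pickleK.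
Qed.

(** Suslin sets are stable under countable unions and intersections but not under complement, so the
    induction over the product sigma-algebra carries the complement along. *)
Let bisuslin (D : set (T * R)) := suslin_set D /\ suslin_set (~` D).

Let bisuslin_sigma : sigma_algebra setT bisuslin.
Proof.
split.
- split; first by rewrite -(set0X (setT : set R)); apply: suslin_rectangle => //; exact: closedT.
  by rewrite setC0 -setXTT; apply: suslin_rectangle => //; exact: closedT.
- by move=> A [sA sCA]; rewrite setTD; split=> //; rewrite setCK.
- move=> A bA; split; first by apply: suslin_bigcup => i; case: (bA i).
  by rewrite setC_bigcup; apply: suslin_bigcap => i; case: (bA i).
Qed.

Lemma measurable_suslin (D : set (T * R)) : measurable D -> suslin_set D.
Proof.
move=> mD; suff [] : bisuslin D by [].
move: D mD; rewrite measurable_prod_measurableType.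
apply: smallest_sub => // _ [A mA [B mB <-]].
have bA : bisuslin (A `*` setT).
  split; first by apply: suslin_rectangle => //; exact: closedT.
  rewrite (_ : ~` _ = (~` A) `*` setT).
    by apply: suslin_rectangle; [exact: measurableC|exact: closedT].
  by rewrite eqEsubset; split => [[x t] /= |[x t] [/= + _]]; tauto.
have bB : bisuslin (setT `*` B).
  pose S := [set B : set R | bisuslin (setT `*` B)].
  suff : measurable `<=` S by apply.
  (* The rays [[x, +oo[] are closed and their complements are countable unions of closed rays, so
     both sides are Suslin. *)
  have -> : @measurable _ R = (@RGenCInfty.G R).-sigma.-measurable.
    exact: RGenCInfty.measurableE.
  apply: smallest_sub.
    split.
    - by rewrite /S/= setX0; case: bisuslin_sigma.
    - move=> C; rewrite /S/= setTD => bC.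
      rewrite (_ : _ `*` _ = ~` (setT `*` C)).
        by have [_ + _] := bisuslin_sigma => /(_ _ bC); rewrite setTD.
      by rewrite eqEsubset; split => [[x t] /= |[x t] /=]; tauto.
    - move=> C bC; rewrite /S/= setX_bigcupr.
      by have [_ _] := bisuslin_sigma; apply.
  move=> _ [x ->]; rewrite /S/=; split.
    by apply: suslin_rectangle => //; apply: interval_closed.
  rewrite (_ : ~` _ = \bigcup_n (setT `*` `]-oo, x - n.+1%:R^-1]%classic)).
    by apply: suslin_bigcup => n; apply: suslin_rectangle => //; exact: interval_closed.
  rewrite -setX_bigcupr; rewrite (_ : ~` _ = setT `*` `]-oo, x[%classic); last first.
    rewrite eqEsubset; split => [[y t] /= h|[y t] /= [_ h]].
      split=> //; rewrite in_itv/= ltNge; apply/negP => xt; apply: h; split=> //.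
      by rewrite in_itv/= xt.
    by move=> [_]; move: h; rewrite !in_itv/= andbT leNgt => ->.
  congr (_ `*` _); rewrite eqEsubset; split => [t|t [n _]]; rewrite /= !in_itv/=.
    move=> tx; have [n nP] := ltr_add_invr tx; exists n => //=.
    by rewrite in_itv/= lerBrDr ltW.
  by move=> /le_lt_trans; apply; rewrite ltrBlDr ltrDl invr_gt0.
have -> : A `*` B = \bigcap_i (if i == 0%N then A `*` setT else setT `*` B).
  rewrite eqEsubset; split => [[x t] [Ax Bt] i _|[x t] h]; first by case: eqP.
  by split; [have [] := h 0%N I|have [] := h 1%N I].
split; first by apply: suslin_bigcap => i; case: eqP => _; [case: bA|case: bB].
rewrite setC_bigcap; apply: suslin_bigcup => i.
by case: eqP => _; [case: bA|case: bB].
Qed.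

(** A cluster point of the witnesses exists in [[-N, N]] by compactness, and each [K n] contains all
    but finitely many of them. *)
Lemma closed_nested_bounded (K : nat -> set R) (N : R) :
  (forall n, closed (K n)) ->
  (forall n, exists t, `|t| <= N /\ forall i, (i <= n)%N -> K i t) ->
  exists t, forall n, K n t.
Proof.
move=> cK /choice[t tP].
have [p [_ clp]] : (`[- N, N] `&` cluster (t @ \oo)) !=set0.
  apply: (@segment_compact R); exists 0%N => // n _ /=.
  by rewrite in_itv/= -ler_norml; have [] := tP n.
exists p => n; apply: cK => V Vp; apply: clp => //.
by exists n => // m /= nm; have [_] := tP m; apply.
Qed.

Lemma measurable_projection (mu : probability T R) (D : set (T * R)) :
  measurable D -> exists P N, [/\ measurable P, measurable N, mu N = 0,
    P `<=` [set x | exists t, D (x, t)] & [set x | exists t, D (x, t)] `<=` P `|` N].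
Proof.
move=> /measurable_suslin[Q [mQ dQ ->]].
(* Digit [0] bounds [t]. Since [K] does not mention [x], the sets [A n s] are measurable, and
   [closed_nested_bounded] turns all the conditions [K n s] into one common [t]. *)
pose K n s := exists t, `|t| <= (s 0%N)%:R :> R /\
  forall i, (i <= n)%N -> (Q i (fun j => s j.+1)).2 t.
pose A n s := [set x | (Q n (fun j => s j.+1)).1 x /\ K n s].
have mA n s : measurable (A n s).
  have [Kns|nKns] := pselect (K n s).
    rewrite (_ : A n s = (Q n (fun j => s j.+1)).1); first by case: (mQ n (fun j => s j.+1)).
    by rewrite eqEsubset; split => x //= [].
  by rewrite (_ : A n s = set0)// eqEsubset; split => x //= [].
have dA : finite_dep A.
  have [b bP] := finite_depP dQ.
  move=> n; exists (\max_(i < n.+1) b i).+1 => s s' ss'.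
  have E i : (i <= n)%N -> Q i (fun j => s j.+1) = Q i (fun j => s' j.+1).
    move=> ni; apply: bP => j jb; apply: ss'.
    rewrite ltnS (leq_trans jb)//.
    exact: (leq_bigmax (F := fun i : 'I_n.+1 => b i) (Ordinal (ni : (i < n.+1)%N))).
  have Kss' : K n s = K n s'.
    rewrite propeqE /K ss'//.
    split=> -[t [t0 tQ]]; exists t; split=> // i ni.
      by rewrite -E//; exact: tQ.
    by rewrite E//; exact: tQ.
  by rewrite /A E// Kss'.
have [P [N [mP mN N0 PA AP]]] := suslin_measurable mu mA dA.
suff E : [set x | exists s, forall n, A n s x] =
    [set x | exists t, [set z | exists s, forall n, (Q n s).1 z.1 /\ (Q n s).2 z.2] (x, t)].
  by rewrite -E; exists P, N.
rewrite eqEsubset; split => x /= [].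
  move=> s sA.
  have [|n|t tQ] := @closed_nested_bounded (fun n => (Q n (fun j => s j.+1)).2) (s 0%N)%:R.
  - by move=> n; have [] := mQ n (fun j => s j.+1).
  - by have [_] := sA n.
  - by exists t, (fun j => s j.+1) => n; split=> //; have [] := sA n.
move=> t [s sQ]; have [N' tN] : exists n : nat, `|t| <= n%:R.
  by exists (Num.bound `|t|); rewrite ltW// archi_boundP.
exists (fun j => if j is j'.+1 then s j' else N') => n; split; first by have [] := sQ n.
by exists t; split => // i _; have [] := sQ i.
Qed.

End SuslinProduct.

Lemma measurable_fun_rat (R : realType) d (T : measurableType d) (h : T -> R) :
  (forall q : rat, measurable [set x | h x < ratr q]) -> measurable_fun setT h.
Proof.
move=> mh; apply: (measurability _ (RGenInftyO.measurableE R)) => //.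
move=> _ [_ [r ->] <-]; rewrite setTI.
rewrite (_ : _ @^-1` _ = \bigcup_(q in [set q : rat | ratr q <= r]) [set x | h x < ratr q]).
  rewrite bigcup_mkcond; apply: countable_bigcupT_measurable => // q.
  by case: ifP.
rewrite eqEsubset; split => x /=; rewrite in_itv/=.
  move=> /rat_in_itvoo[q]; rewrite in_itv/= => /andP[hq qr].
  by exists q => //=; exact: ltW.
by move=> [q /= qr hq]; exact: lt_le_trans qr.
Qed.

Section NullSets.
Context (R : realType) (d : measure_display) (T : measurableType d).
Variable mu : {measure set T -> \bar R}.

Definition null_set (A : set T) := measurable A /\ mu A = 0%E.

Lemma null_set0 : null_set set0.
Proof. by split; rewrite ?measure0. Qed.

Lemma null_sub A B : measurable A -> A `<=` B -> null_set B -> null_set A.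
Proof.
move=> mA AB [mB B0]; split=> //; apply/eqP; rewrite eq_le measure_ge0 andbT -B0.
by apply: le_measure; rewrite ?inE.
Qed.

Lemma null_bigcup (I : countType) (N : I -> set T) :
  (forall i, null_set (N i)) -> null_set (\bigcup_i N i).
Proof.
move=> nN; have mU : measurable (\bigcup_i N i).
  by apply: countable_bigcupT_measurable => // i; case: (nN i).
split=> //; apply/eqP; rewrite eq_le measure_ge0 andbT.
pose M n := if @unpickle I n is Some i then N i else set0.
have nM n : null_set (M n) by rewrite /M; case: unpickle => [i|]//; exact: null_set0.
have -> : \bigcup_i N i = \bigcup_n M n.
  rewrite eqEsubset; split => [x [i _ Nx]|x [n _]].
    by exists (pickle i) => //; rewrite /M pickleK.
  by rewrite /M; case: unpickle => // i Nx; exists i.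
have mM n : measurable (M n) by case: (nM n).
apply: (le_trans (measure_sigma_subadditive mu mM (bigcupT_measurable M mM) (@subset_refl _ _))).
by rewrite eseries0// => n _ _; case: (nM n).
Qed.

Lemma nullU A B : null_set A -> null_set B -> null_set (A `|` B).
Proof.
move=> nA nB; rewrite (_ : A `|` B = \bigcup_b (if b then A else B)).
  by apply: null_bigcup => -[].
rewrite eqEsubset; split => [x [Ax|Bx]|x [[] _]]; [|by exists false|by left|by right].
by exists true.
Qed.

End NullSets.

Lemma seq_argmin (R : realType) (T : eqType) (f : T -> R) (y0 : T) (s : seq T) :
  y0 \in s -> exists2 y, y \in s & forall y', y' \in s -> f y <= f y'.
Proof.
elim: s y0 => // a s IH y0 _; case: s IH => [_|b s IH].
  by exists a; rewrite ?inE// => y'; rewrite inE => /eqP ->.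
have [y ys ymin] := IH b (mem_head _ _).
have [fay|fya] := leP (f a) (f y).
  exists a; rewrite ?mem_head// => y'; rewrite inE => /predU1P[->//|/ymin].
  exact: le_trans.
exists y; first by rewrite in_cons ys orbT.
move=> y'; rewrite inE => /predU1P[->|/ymin//].
exact: ltW.
Qed.

(** * Borel selection and enumeration of the neighbours *)

Section StandardBorel.
Context (R : realType) (d : measure_display) (X : measurableType d).

(** The map [r |-> exp (- exp r)] is a Borel isomorphism of the line onto []0, 1[]. Values in that
    interval suit the generalised inverse [rat_inf], whose thresholds are capped at [1]. *)
Lemma standard_borel_itv : standard_borel R X -> exists f : X -> R,
  [/\ measurable_fun setT f, injective f,
     forall A, measurable A -> measurable (f @` A) & forall x, 0 < f x < 1].
Proof.
move=> [f [mf [injf imf]]].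
pose h (r : R) : R := expR (- expR r); pose k (s : R) : R := ln (- ln s).
have hK : cancel h k by move=> r; rewrite /h /k expRK opprK expRK.
have h01 r : 0 < h r < 1 by rewrite expR_gt0/= expR_lt1 oppr_lt0 expR_gt0.
have kK s : 0 < s < 1 -> h (k s) = s.
  move=> /andP[s0 s1]; rewrite /h /k lnK ?opprK ?lnK//.
  by rewrite posrE oppr_gt0 ln_lt0// s0.
have mh : measurable_fun setT h.
  apply: measurableT_comp; first exact: measurable_expR.
  by apply: measurableT_comp; [exact: oppr_measurable|exact: measurable_expR].
have mk : measurable_fun setT k.
  apply: measurableT_comp; first exact: measurable_ln.
  by apply: measurableT_comp; [exact: oppr_measurable|exact: measurable_ln].
exists (h \o f); split.
- exact: measurableT_comp.
- by apply: inj_comp => //; exact: can_inj hK.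
- move=> A mA; rewrite (_ : _ @` _ = `]0, 1[%classic `&` k @^-1` (f @` A)).
    by apply: measurableI => //; rewrite -[_ @^-1` _]setTI; apply: mk => //; exact: imf.
  rewrite eqEsubset; split => [_ [x Ax <-]|s [/=]].
    by split; rewrite /= ?hK; [rewrite in_itv/= h01|exists x].
  rewrite in_itv/= => s01 [x Ax fx]; exists x => //=.
  by rewrite fx kK.
- by move=> x; exact: h01.
Qed.

Variable f : X -> R.
Hypotheses (mf : measurable_fun setT f) (injf : injective f).
Hypothesis imf : forall A, measurable A -> measurable (f @` A).

(** A total left inverse, equal to [point] off the range; membership in the range can then be tested
    by the Borel condition [f (finv t) = t]. *)
Definition finv (t : R) : X :=
  if pselect (exists x, f x = t) is left e then projT1 (cid e) else point.

Lemma finvK : cancel f finv.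
Proof.
move=> x; rewrite /finv; case: pselect => [e|[]]; last by exists x.
by case: cid => y /= /injf.
Qed.

Lemma measurable_finv : measurable_fun setT finv.
Proof.
move=> _ C mC; rewrite setTI.
rewrite (_ : _ @^-1` _ = (f @` C) `|` (if `[< C point >] then ~` (f @` setT) else set0)).
  by apply: measurableU; [exact: imf|case: ifP => // _; apply: measurableC; exact: imf].
rewrite eqEsubset; split => t /=.
  have [[x <-]|nt] := pselect (exists x, f x = t); first by rewrite finvK; left; exists x.
  rewrite /finv; case: pselect => // _ Cp; right; rewrite asboolT//=.
  by move=> [x _ fx]; apply: nt; exists x.
case; first by move=> [x Cx <-]; rewrite finvK.
case: asboolP => // Cp nt; rewrite /finv; case: pselect => // e.
by exfalso; apply: nt; case: e => x fx; exists x.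
Qed.

Lemma measurable_eqset d' (T : measurableType d') (g h : T -> X) :
  measurable_fun setT g -> measurable_fun setT h -> measurable [set x | g x = h x].
Proof.
move=> mg mh; rewrite (_ : mkset _ = (fun x => f (g x) - f (h x)) @^-1` [set 0]).
  rewrite -[_ @^-1` _]setTI; apply: measurable_funB => //; exact: measurableT_comp.
rewrite eqEsubset; split => x /=; first by move=> ->; rewrite subrr.
by move=> /subr0_eq /injf.
Qed.

Lemma measurable_eqsetR d' (T : measurableType d') (g h : T -> R) :
  measurable_fun setT g -> measurable_fun setT h -> measurable [set x | g x = h x].
Proof.
move=> mg mh; rewrite (_ : mkset _ = (fun x => g x - h x) @^-1` [set 0]).
  by rewrite -[_ @^-1` _]setTI; apply: measurable_funB.
rewrite eqEsubset; split => x /=; first by move=> ->; rewrite subrr.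
exact: subr0_eq.
Qed.

(** The selected point minimises [f] over the finite section. The minimum is below [q] exactly when
    the section meets the points with [f < q]; this is a projection, hence measurable up to a null
    set, and discarding these null sets for all rational [q] makes the minimum measurable. *)
Lemma measurable_selection (mu : probability X R) (D : set (X * X)) (G0 : set X) :
  measurable D -> null_set mu (~` G0) ->
  (forall x, G0 x -> finite_set [set y | D (x, y)] /\ exists y, D (x, y)) ->
  exists s G, [/\ measurable_fun setT s, null_set mu (~` G), G `<=` G0 &
    forall x, G x -> D (x, s x)].
Proof.
move=> mD [mG0 nG0] finD.
pose DR (q : rat) : set (X * R) :=
  [set z | [/\ f (finv z.2) = z.2, z.2 < ratr q & D (z.1, finv z.2)]].
have mDR q : measurable (DR q).
  rewrite (_ : DR q = [set z | f (finv z.2) = z.2] `&`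
     (snd @^-1` `]-oo, ratr q[ `&` (fun z => (z.1, finv z.2)) @^-1` D)).
    apply: measurableI.
      apply: measurable_eqsetR => //; apply: measurableT_comp => //.
      by apply: measurableT_comp => //; exact: measurable_finv.
    apply: measurableI; first by rewrite -[_ @^-1` _]setTI; exact: measurable_snd.
    rewrite -[_ @^-1` _]setTI; apply: measurable_fun_pair => //.
    by apply: measurableT_comp; [exact: measurable_finv|exact: measurable_snd].
  by rewrite eqEsubset; split => z /=; rewrite in_itv/= => -[? ]; [|case].
have /choice[PN PNP] : forall q, exists PN : set X * set X, [/\ measurable PN.1, null_set mu PN.2,
    PN.1 `<=` [set x | exists t, DR q (x, t)] &
    [set x | exists t, DR q (x, t)] `<=` PN.1 `|` PN.2].
  move=> q; have [P [N [mP mN N0 PD DP]]] := measurable_projection mu (mDR q).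
  by exists (P, N).
pose G := G0 `\` \bigcup_q (PN q).2.
have nG : null_set mu (~` G).
  rewrite (_ : ~` G = ~` G0 `|` \bigcup_q (PN q).2).
    by apply: nullU => //; apply: null_bigcup => q; case: (PNP q).
  by rewrite /G setDE setCI setCK.
have mG : measurable G by rewrite -[G]setCK; apply: measurableC; case: nG.
have min x : exists y, G0 x -> D (x, y) /\ forall y', D (x, y') -> f y <= f y'.
  have [/finD[fD [y0 Dy0]]|] := pselect (G0 x); last by exists point.
  have [s sE] := (finite_seqP _).1 fD.
  have sy0 : y0 \in s by have : [set` s] y0 by rewrite -sE.
  have [y ys ymin] := seq_argmin f sy0.
  have mem_s y' : D (x, y') <-> y' \in s.
    by have : [set y | D (x, y)] y' <-> [set` s] y' by rewrite sE.
  by exists y => _; split; [exact/mem_s|move=> y' /mem_s; exact: ymin].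
have [m mP] := choice min.
(* Constant off [G], so that [s] is measurable on the whole space. *)
pose s x := if `[< G x >] then m x else point.
pose tau x := if `[< G x >] then f (m x) else f point.
have mtau : measurable_fun setT tau.
  apply: measurable_fun_rat => q.
  rewrite (_ : mkset _ = (G `&` (PN q).1) `|`
      (~` G `&` (if f point < ratr q then setT else set0))); last first.
    rewrite eqEsubset; split => x /=; rewrite /tau; case: asboolP => Gx.
    - move=> fq; left; split=> //; have [_ _ _] := PNP q.
      have [G0x Nx] := Gx; have [Dm _] := mP x G0x.
      move=> /(_ x) []//; first by exists (f (m x)); split; rewrite /= ?finvK.
      by move=> Nq; exfalso; apply: Nx; exists q.
    - by move=> ->; right.
    - case=> -[// _ Px]; have [_ _ + _] := PNP q.
      move=> /(_ x Px)[t [/= ft tq Dt]].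
      have [G0x _] := Gx; have [_ /(_ _ Dt)] := mP x G0x.
      by rewrite ft => /le_lt_trans; apply.
    - by case=> -[//]; case: ifP.
  apply: measurableU; apply: measurableI => //.
  - by case: (PNP q).
  - by case: nG.
  - by case: ifP.
exists s, G; split => //.
- rewrite (_ : s = finv \o tau); first exact: (measurableT_comp measurable_finv).
  by apply/funext => x; rewrite /s /tau /=; case: asboolP => _; rewrite finvK.
- by move=> x [].
- move=> x Gx; rewrite /s; case: asboolP => // -[G0x _].
  by have [] := mP x G0x.
Qed.

End StandardBorel.

Section Enumeration.
Context (R : realType) (d : measure_display) (X : measurableType d).
Variables (mu : probability X R) (f : X -> R).
Hypotheses (mf : measurable_fun setT f) (injf : injective f).
Hypothesis imf : forall A, measurable A -> measurable (f @` A).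
Variables (E : X -> X -> Prop) (n : nat).
Hypotheses (bE : borel_graph E) (rE : regular mu E n).

Let regular_set : exists G, null_set mu (~` G) /\
  forall x, G x -> (nbhd E x #= `I_n)%card.
Proof.
have [N [mN N0 NP]] := rE; exists (~` N); split; first by rewrite setCK; split.
by move=> x Nx; apply: contrapT => h; apply: Nx; exact: NP.
Qed.

(** While [k < n], the neighbours not yet listed form a Borel set with nonempty finite sections over
    the good points, so one more selection applies. *)
Let partial_enumeration k : (k <= n)%N -> exists (phi : nat -> X -> X) G,
  [/\ forall i, measurable_fun setT (phi i), null_set mu (~` G),
    forall x, G x -> (nbhd E x #= `I_n)%card,
    forall x i, G x -> (i < k)%N -> E x (phi i x) &
    forall x i j, G x -> (i < k)%N -> (j < k)%N -> phi i x = phi j x -> i = j].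
Proof.
elim: k => [|k IH] kn.
  have [G [nG GP]] := regular_set; exists (fun _ => id), G; split => //.
have [phi [G [mphi nG GP phiE phi_inj]]] := IH (ltnW kn).
pose D : set (X * X) := [set z | E z.1 z.2 /\ forall i, (i < k)%N -> z.2 <> phi i z.1].
have mD : measurable D.
  rewrite (_ : D = [set z | E z.1 z.2] `&`
      \bigcap_(i in `I_k) ~` [set z | z.2 = phi i z.1]).
    apply: measurableI; first by case: bE => _ [].
    apply: bigcap_measurableType => i _; apply: measurableC.
    apply: (measurable_eqset mf injf); first exact: measurable_snd.
    exact: measurableT_comp.
  by rewrite eqEsubset; split.
have [|s [G' [ms nG' G'G sD]]] := measurable_selection mf injf imf mD nG.
  move=> x Gx; have nx := GP x Gx; split.
    apply: (@sub_finite_set _ _ (nbhd E x)); first by move=> y [].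
    by rewrite (eq_finite_set nx); exact: finite_II.
  apply: contrapT => /forallNP nD.
  have : (`I_n #<= `I_k)%card.
    rewrite -(card_le_eql nx); apply: card_le_trans (card_image_le (phi^~ x) _).
    apply: subset_card_le => y Exy; apply: contrapT => ny; apply: (nD y).
    by split=> // i ik yi; apply: ny; exists i.
  by rewrite card_le_II leqNgt kn.
exists (fun i => if (i < k)%N then phi i else s), G'; split => //.
- by move=> i; case: ifP.
- by move=> x G'x; apply/GP/G'G.
- move=> x i G'x; rewrite ltnS leq_eqVlt => /predU1P[->|ik].
    by rewrite ltnn; have [] := sD x G'x.
  by rewrite ik; apply: phiE => //; exact: G'G.
- move=> x i j G'x; have [_ /= sP] := sD x G'x.
  rewrite ltnS leq_eqVlt => /predU1P[->|ik]; rewrite ltnS leq_eqVlt => /predU1P[->|jk] //.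
  + by rewrite ltnn jk => /sP; rewrite jk => /(_ isT).
  + by rewrite ltnn ik => /esym /sP; rewrite ik => /(_ isT).
  + by rewrite ik jk => /phi_inj; apply => //; exact: G'G.
Qed.

Lemma neighbour_enumeration : exists (phi : nat -> X -> X) G,
  [/\ forall i, measurable_fun setT (phi i), null_set mu (~` G),
    forall x i, G x -> (i < n)%N -> E x (phi i x),
    forall x i j, G x -> (i < n)%N -> (j < n)%N -> phi i x = phi j x -> i = j &
    forall x y, G x -> E x y -> exists2 i, (i < n)%N & y = phi i x].
Proof.
have [phi [G [mphi nG GP phiE phi_inj]]] := partial_enumeration (leqnn n).
exists phi, G; split => // x y Gx Exy; apply: contrapT => ny.
(* A neighbour missed by the list would produce [n.+1] distinct neighbours. *)
pose h i := if (i < n)%N then phi i x else y.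
have : (`I_n.+1 #<= `I_n)%card.
  rewrite -(card_le_eqr (GP x Gx)) -(@card_le_eql _ _ _ (h @` `I_n.+1)).
    apply: subset_card_le => _ [i _ <-]; rewrite /h; case: ifP => // ii.
    exact: phiE.
  apply: inj_card_eq => i j; rewrite !inE/= /h.
  rewrite ltnS leq_eqVlt => /predU1P[->|ii]; rewrite ltnS leq_eqVlt => /predU1P[->|jj] //;
    rewrite ?ltnn ?ii ?jj.
  - by move=> e; exfalso; apply: ny; exists j.
  - by move=> e; exfalso; apply: ny; exists i.
  - exact: phi_inj.
by rewrite card_le_II ltnn.
Qed.

End Enumeration.

(** * Uniqueness of measures and bounded densities *)

Section MeasureTools.
Context (R : realType).

Lemma exists_pushforward d1 d2 (T1 : measurableType d1) (T2 : measurableType d2)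
    (m : {measure set T1 -> \bar R}) (h : T1 -> T2) : measurable_fun setT h ->
  exists m' : {measure set T2 -> \bar R}, forall A, m' A = m (h @^-1` A).
Proof. by move=> mh; unshelve eexists (pushforward m h). Qed.

Lemma exists_restr d (T : measurableType d) (m : {measure set T -> \bar R}) (D : set T) :
  measurable D -> exists m' : {measure set T -> \bar R}, forall A, m' A = m (A `&` D).
Proof. by move=> mD; exists (mrestr m mD). Qed.

Lemma exists_finite d (T : measurableType d) (m : {measure set T -> \bar R}) :
  (m setT < +oo)%E ->
  exists m' : {finite_measure set T -> \bar R}, forall A, m' A = m A.
Proof.
move=> moo; exists (mfrestr measurableT moo) => A.
by rewrite /= /mfrestr /mrestr setIT.
Qed.

Lemma measure_prod_unique d (Y : measurableType d)
    (m1 m2 : {measure set (Y * R) -> \bar R}) :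
  (m1 setT < +oo)%E ->
  (forall V r, measurable V -> m1 (V `*` `]-oo, r[) = m2 (V `*` `]-oo, r[)) ->
  forall D, measurable D -> m1 D = m2 D.
Proof.
move=> m1oo m12 D mD.
pose G : set (set (Y * R)) := [set A | exists V r, measurable V /\ A = V `*` `]-oo, r[%classic].
have GE : measurable = <<s G >>.
  rewrite measurable_prod_measurableType eqEsubset; split; last first.
    apply: smallest_sub; first exact: smallest_sigma_algebra.
    move=> _ [V [r [mV ->]]]; apply: sub_sigma_algebra; exists V => //.
    by exists `]-oo, r[%classic.
  apply: smallest_sub; first exact: smallest_sigma_algebra.
  move=> _ [V mV [B mB <-]].
  have VT : <<s G >> (V `*` setT).
    rewrite (_ : _ `*` _ = \bigcup_n (V `*` `]-oo, n%:R[%classic)).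
      apply: sigma_algebra_bigcup => n; apply: sub_sigma_algebra.
      by exists V, n%:R.
    rewrite -setX_bigcupr; congr (_ `*` _); rewrite eqEsubset; split => // t _.
    exists (Num.bound `|t|) => //=; rewrite in_itv/=.
    by rewrite (le_lt_trans (ler_norm t))// archi_boundP.
  pose S := [set B : set R | <<s G >> (V `*` B)].
  suff : measurable `<=` S by apply.
  have -> : @measurable _ R = (@RGenInftyO.G R).-sigma.-measurable.
    exact: RGenInftyO.measurableE.
  apply: smallest_sub; last first.
    by move=> _ [r ->]; apply: sub_sigma_algebra; exists V, r.
  split.
  - by rewrite /S/= setX0; exact: sigma_algebra0.
  - move=> C SC; rewrite /S/= setTD.
    rewrite (_ : _ `*` _ = (V `*` setT) `\` (V `*` C)).
      exact: (@measurableD _ (g_sigma_algebraType G) _ _ VT SC).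
    rewrite eqEsubset; split => [[x t] [/= Vx Ct]|[x t] /= [[Vx _] h]].
      by split=> // -[].
    by split=> // Ct; apply: h.
  - by move=> C SC; rewrite /S/= setX_bigcupr; apply: sigma_algebra_bigcup.
apply: (measure_unique G (fun n => setT `*` `]-oo, n%:R[%classic)) => //.
- move=> _ _ [V [r [mV ->]]] [W [s [mW ->]]].
  exists (V `&` W), (Num.min r s); split; first exact: measurableI.
  rewrite -setXI; congr (_ `*` _); rewrite eqEsubset; split => t /=.
    by rewrite !in_itv/= lt_min => -[-> ->].
  by rewrite !in_itv/= lt_min => /andP[].
- by move=> n; exists setT, n%:R.
- rewrite -setX_bigcupr -setXTT; congr (_ `*` _).
  rewrite eqEsubset; split => // t _.
  exists (Num.bound `|t|) => //=; rewrite in_itv/=.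
  by rewrite (le_lt_trans (ler_norm t))// archi_boundP.
- by move=> _ [V [r [mV ->]]]; exact: m12.
- move=> n; apply: le_lt_trans m1oo; apply: le_measure; rewrite ?inE//.
  exact: measurableX.
Qed.

Lemma rat_seq_lt (r : R) : exists p : nat -> rat,
  [/\ forall m n, (m <= n)%N -> p m <= p n, forall n, ratr (p n) < r &
   forall s, s < r -> exists n, s < ratr (p n)].
Proof.
have lt_inv (n : nat) : r - n.+1%:R^-1 < r - n.+2%:R^-1 :> R.
  by rewrite ltrD2l ltrN2 ltf_pV2 ?posrE// ltr_nat.
have /choice[p pP] : forall n : nat, exists q : rat, ratr q \in `]r - n.+1%:R^-1, r - n.+2%:R^-1[.
  by move=> n; have [q] := rat_in_itvoo (lt_inv n); exists q.
have pP1 n : r - n.+1%:R^-1 < ratr (p n) by have := pP n; rewrite in_itv/= => /andP[].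
have pP2 n : ratr (p n) < r - n.+2%:R^-1 by have := pP n; rewrite in_itv/= => /andP[].
exists p; split.
- have pS n : p n <= p n.+1.
    by rewrite -(ler_rat R) ltW// (lt_trans (pP2 n)).
  move=> m n /subnK <-; elim: (n - m)%N => // k IH; rewrite addSn.
  exact: le_trans IH _.
- by move=> n; apply: (lt_trans (pP2 n)); rewrite ltrBlDr ltrDl invr_gt0.
- move=> s sr; have [n nP] := ltr_add_invr sr; exists n.
  by apply: le_lt_trans (pP1 n); rewrite lerBrDr ltW.
Qed.

Lemma measure_bigcup_le d (T : measurableType d) (m : {measure set T -> \bar R})
    (B : nat -> set T) (c : \bar R) :
  (forall n, measurable (B n)) -> (forall i j, (i <= j)%N -> B i `<=` B j) ->
  (forall n, m (B n) <= c)%E -> (m (\bigcup_n B n) <= c)%E.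
Proof.
move=> mB ndB Bc; have cvgB : m \o B @ \oo --> m (\bigcup_n B n).
  apply: nondecreasing_cvg_mu => //; first exact: bigcupT_measurable.
  by move=> i j ij; apply/subsetPset; exact: ndB.
rewrite -(cvg_lim _ cvgB)//; apply: lime_le; last exact: nearW.
by apply/cvg_ex; eexists; exact: cvgB.
Qed.

(** A generalised inverse controls open rays from one side and closed rays from the other. Rational
    thresholds increasing to [r] absorb the difference. *)
Lemma measure_prod_unique_sandwich d (Y : measurableType d)
    (m1 m2 : {measure set (Y * R) -> \bar R}) :
  (m1 setT < +oo)%E ->
  (forall V p, measurable V -> (m1 (V `*` `]-oo, ratr p[) <= m2 (V `*` `]-oo, ratr p]))%E) ->
  (forall V p, measurable V -> (m2 (V `*` `]-oo, ratr p]) <= m1 (V `*` `]-oo, ratr p]))%E) ->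
  forall D, measurable D -> m1 D = m2 D.
Proof.
move=> m1oo h1 h2; apply: measure_prod_unique => // V r mV.
have [p [ndp pr rp]] := rat_seq_lt r.
have ndr i j : (i <= j)%N -> ratr (p i) <= ratr (p j) :> R.
  by move=> /ndp; rewrite ler_rat.
have Uo : \bigcup_n (V `*` `]-oo, ratr (p n)[%classic) = V `*` `]-oo, r[%classic.
  rewrite -setX_bigcupr; congr (_ `*` _); rewrite eqEsubset; split => t.
    by move=> [n _]; rewrite /= !in_itv/= => /lt_trans; apply.
  by rewrite /= in_itv/= => /rp[n tn]; exists n => //=; rewrite in_itv.
have Uc : \bigcup_n (V `*` `]-oo, ratr (p n)]%classic) = V `*` `]-oo, r[%classic.
  rewrite -setX_bigcupr; congr (_ `*` _); rewrite eqEsubset; split => t.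
    by move=> [n _]; rewrite /= !in_itv/= => /le_lt_trans; apply.
  by rewrite /= in_itv/= => /rp[n tn]; exists n => //=; rewrite in_itv/= ltW.
have mr : measurable (V `*` `]-oo, r[%classic) by exact: measurableX.
apply/eqP; rewrite eq_le; apply/andP; split.
- rewrite -{1}Uo; apply: measure_bigcup_le => [n|i j ij [y t] /= [Vy]|n].
  + exact: measurableX.
  + by rewrite !in_itv/= => tp; split=> //; exact: lt_le_trans (ndr _ _ ij).
  + apply: (le_trans (h1 _ _ mV)); rewrite -Uc; apply: le_measure; rewrite ?inE//.
    * exact: measurableX.
    * by rewrite Uc.
    * by move=> z; exists n.
- rewrite -{1}Uc; apply: measure_bigcup_le => [n|i j ij [y t] /= [Vy]|n].
  + exact: measurableX.
  + by rewrite !in_itv/= => tp; split=> //; exact: le_trans (ndr _ _ ij).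
  + apply: (le_trans (h2 _ _ mV)); rewrite -Uc; apply: le_measure; rewrite ?inE//.
    * exact: measurableX.
    * by rewrite Uc.
    * by move=> z; exists n.
Qed.

(** Where [F1] exceeds [F2] by [1/(n+1)], the integrals differ by at least that multiple of the
    measure; finiteness of the integral of [F1] allows the cancellation. *)
Lemma density_le d (Y : measurableType d) (nu : {finite_measure set Y -> \bar R})
    (F1 F2 : Y -> R) :
  measurable_fun setT F1 -> measurable_fun setT F2 ->
  (forall y, 0 <= F1 y) -> (forall y, 0 <= F2 y) ->
  (forall V, measurable V -> \int[nu]_(y in V) (F1 y)%:E < +oo)%E ->
  (forall V, measurable V ->
    \int[nu]_(y in V) (F1 y)%:E <= \int[nu]_(y in V) (F2 y)%:E)%E ->
  null_set nu [set y | F2 y < F1 y].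
Proof.
move=> mF1 mF2 F10 F20 Foo F12.
pose A (n : nat) := [set y | F2 y + n.+1%:R^-1 <= F1 y].
have mA n : measurable (A n).
  rewrite (_ : A n = (fun y => F1 y - (F2 y + n.+1%:R^-1)) @^-1` `[0, +oo[).
    rewrite -[_ @^-1` _]setTI; apply: measurable_funB => //.
    exact: measurable_funD.
  by rewrite eqEsubset; split => y /=; rewrite /A/= in_itv/= andbT subr_ge0.
have A0 n : nu (A n) = 0%E.
  have e0 : 0 < n.+1%:R^-1 :> R by rewrite invr_gt0.
  have h : (\int[nu]_(y in A n) (F2 y)%:E + n.+1%:R^-1%:E * nu (A n) <=
      \int[nu]_(y in A n) (F1 y)%:E)%E.
    have c0 y : A n y -> (0 <= cst (n.+1%:R^-1 : R)%:E y)%E by rewrite lee_fin ltW.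
    have mc : measurable_fun (A n) (cst n.+1%:R^-1%:E : Y -> \bar R) by exact: measurable_cst.
    have p1 y : A n y -> (0 <= (F1 y)%:E)%E by rewrite lee_fin.
    have p2 y : A n y -> (0 <= (F2 y)%:E)%E by rewrite lee_fin.
    have m1 : measurable_fun (A n) (fun y => (F1 y)%:E).
      by apply/measurable_EFinP; exact: measurable_funTS.
    have m2 : measurable_fun (A n) (fun y => (F2 y)%:E).
      by apply/measurable_EFinP; exact: measurable_funTS.
    rewrite -integral_cst// -ge0_integralD//.
    apply: ge0_le_integral => //; last exact: emeasurable_funD.
    by move=> y Ay; rewrite adde_ge0// ?p2// c0.
  have F2oo : (\int[nu]_(y in A n) (F1 y)%:E)%E \is a fin_num.
    rewrite ge0_fin_numE ?Foo//; apply: integral_ge0 => y _.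
    by rewrite lee_fin.
  have h' : (\int[nu]_(y in A n) (F1 y)%:E + n.+1%:R^-1%:E * nu (A n) <=
      \int[nu]_(y in A n) (F1 y)%:E + 0)%E.
    by rewrite adde0; apply: le_trans h; apply: leeD2r; exact: F12.
  apply/eqP; rewrite eq_le measure_ge0 andbT.
  move: h'; rewrite leeD2lE// => h'.
  by rewrite -(@lee_pmul2l _ n.+1%:R^-1%:E)// ?mule0.
rewrite (_ : mkset _ = \bigcup_n A n); first exact: (null_bigcup (fun n => conj (mA n) (A0 n))).
rewrite eqEsubset; split => y /=.
  by move=> /ltr_add_invr[n nP]; exists n => //; exact: ltW.
by move=> [n _]; apply: lt_le_trans; rewrite ltrDl invr_gt0.
Qed.

(** A Radon-Nikodym density exceeds [1] only on a null set, so truncating it gives the bounds at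
    every point. *)
Lemma bounded_density d (Y : measurableType d) (nu nu' : {finite_measure set Y -> \bar R}) :
  (forall V, measurable V -> nu' V <= nu V)%E ->
  exists F : Y -> R, [/\ measurable_fun setT F, forall y, 0 <= F y <= 1 &
    forall V, measurable V -> nu' V = (\int[nu]_(y in V) (F y)%:E)%E].
Proof.
move=> le_nu.
have [|h [h0 hfin inth hE]] := @radon_nikodym_sigma_finite _ _ _ nu nu'.
  by apply/null_content_dominatesP => A mA A0; apply/eqP;
    rewrite eq_le measure_ge0 andbT -A0; exact: le_nu.
pose H y := fine (h y).
have HE y : (H y)%:E = h y by rewrite fineK.
have mH : measurable_fun setT H.
  apply/measurable_EFinP; rewrite (_ : _ \o _ = h).
    exact: measurable_int inth.
  by apply/funext => y /=; rewrite HE.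
have H0 y : 0 <= H y by rewrite fine_ge0.
have intH V : measurable V -> nu' V = (\int[nu]_(y in V) (H y)%:E)%E.
  by move=> mV; rewrite hE//; apply: eq_integral => y _; rewrite HE.
have nH : null_set nu [set y | 1 < H y].
  apply: (@density_le _ _ nu H (fun=> 1)) => //.
  - by move=> V mV; rewrite -intH// -ge0_fin_numE// fin_num_measure.
  - by move=> V mV; rewrite -intH// integral_cst// mul1e; exact: le_nu.
pose F y := Num.min (H y) 1.
have mF : measurable_fun setT F by apply: measurable_minr.
exists F; split => // [y|V mV].
  by rewrite /F le_min H0 ler01/= ge_min lexx orbT.
rewrite intH//; apply: ae_eq_integral => //.
- by apply/measurable_EFinP; exact: measurable_funTS.
- by apply/measurable_EFinP; exact: measurable_funTS.
- exists [set y | 1 < H y]; split; [by case: nH|by case: nH|].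
  move=> y /= /not_implyP[_ /eqP]; rewrite /F eqe => h1.
  by rewrite ltNge; apply/negP => h2; move: h1; rewrite min_l// eqxx.
Qed.

End MeasureTools.

(** * The uniform law and generalised inverses *)

Section UnitInterval.
Context (R : realType).

(** This is the distribution function of the uniform law on [[0, 1]]. *)
Definition clamp (r : R) : R := Num.max 0 (Num.min r 1).

Lemma clamp_id r : 0 <= r <= 1 -> clamp r = r.
Proof. by move=> /andP[r0 r1]; rewrite /clamp min_l// max_r. Qed.

(* lebesgue_measure lives on the alias measurableTypeR R of R. *)
Lemma exists_uniform : exists leb : {finite_measure set R -> \bar R},
  [/\ leb setT = 1%E, forall r, leb `]-oo, r[%classic = (clamp r)%:E & leb (~` `[0, 1]%classic) = 0%E].
Proof.
have mid : measurable_fun setT (idfun : measurableTypeR R -> R).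
  by move=> _ A mA; rewrite setTI.
have [m1 m1E] := exists_pushforward (@lebesgue_measure R) mid.
have m01 : measurable (`[0, 1]%classic : set R) by [].
have [m2 m2E] := exists_restr m1 m01.
have m2T : m2 setT = 1%E.
  rewrite m2E m1E setTI preimage_id [LHS]lebesgue_measure_itv/= lte_fin ltr01.
  by rewrite oppr0 adde0.
have [|m3 m3E] := @exists_finite _ _ _ m2; first by rewrite m2T ltry.
exists m3; split; [by rewrite m3E| |by rewrite m3E m2E setICl measure0].
move=> r; rewrite m3E m2E m1E preimage_id /clamp.
have [r1|r1] := leP r 1.
  rewrite (_ : _ `&` _ = `[0, r[%classic); last first.
    rewrite eqEsubset; split => u /=; rewrite !in_itv/=; first by move=> [-> /andP[->]].
    by move=> /andP[-> ur]; rewrite ur (ltW (lt_le_trans ur r1)).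
  rewrite [LHS]lebesgue_measure_itv/= lte_fin oppr0 adde0.
  by have [|] := ltP 0 r.
rewrite (_ : _ `&` _ = `[0, 1]%classic); last first.
  rewrite eqEsubset; split => u /=; rewrite !in_itv/=; first by move=> [].
  by move=> /andP[-> u1]; rewrite u1 (le_lt_trans u1 r1).
rewrite [LHS]lebesgue_measure_itv/= lte_fin ltr01 oppr0 adde0.
by rewrite max_r// ler01.
Qed.

Lemma measure_ray_unique (m1 m2 : {measure set R -> \bar R}) :
  (m1 setT < +oo)%E -> (forall r, m1 `]-oo, r[%classic = m2 `]-oo, r[%classic) ->
  forall A, measurable A -> m1 A = m2 A.
Proof.
move=> m1oo m12 A mA.
apply: (measure_unique (@RGenInftyO.G R) (fun n => `]-oo, n%:R[%classic)) => //.
- exact: RGenInftyO.measurableE.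
- move=> _ _ [r ->] [s ->]; exists (Num.min r s).
  rewrite eqEsubset; split => t /=; rewrite !in_itv/= lt_min; first by move=> [-> ->].
  by move=> /andP[].
- by move=> n; exists n%:R.
- rewrite eqEsubset; split => // t _.
  exists (Num.bound `|t|) => //=; rewrite in_itv/=.
  by rewrite (le_lt_trans (ler_norm t))// archi_boundP.
- by move=> _ [r ->].
- move=> n; apply: le_lt_trans m1oo; apply: le_measure; rewrite ?inE//.
Qed.

(** If [u] is uniform, the law of [u / 2] is twice the uniform law restricted to []-oo, 1/2[], hence
    absolutely continuous. *)
Lemma uniform_half_null (leb : {finite_measure set R -> \bar R}) :
  (forall r, leb `]-oo, r[%classic = (clamp r)%:E) ->
  forall A, measurable A -> leb A = 0%E -> leb [set u | A (u / 2)] = 0%E.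
Proof.
move=> lebE A mA A0.
have mh : measurable_fun setT (fun u : R => u / 2) by exact: measurable_funM.
have [m1 m1E] := exists_pushforward leb mh.
have mr : measurable (`]-oo, 2^-1[%classic : set R) by [].
have [m2 m2E] := exists_restr leb mr.
have [m3 m3E] : exists m3 : {measure set R -> \bar R}, forall B, m3 B = (2%:E * m2 B)%E.
  by exists (mscale 2%:nng m2) => B; rewrite /= /mscale.
have m13 : forall B, measurable B -> m1 B = m3 B.
  apply: measure_ray_unique.
    by rewrite m1E preimage_setT -ge0_fin_numE// fin_num_measure.
  move=> r; rewrite m1E m3E m2E.
  have -> : (fun u : R => u / 2) @^-1` `]-oo, r[ = `]-oo, 2 * r[%classic.
    rewrite eqEsubset; split => u /=; rewrite !in_itv/=; lra.
  have -> : `]-oo, r[ `&` `]-oo, 2^-1[ = `]-oo, Num.min r 2^-1[%classic.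
    rewrite eqEsubset; split => t /=; rewrite !in_itv/= lt_min; first by move=> [-> ->].
    by move=> /andP[].
  rewrite [LHS]lebE [X in (_ * X)%E]lebE -EFinM; congr (_%:E); rewrite /clamp.
  by rewrite /Num.min /Num.max; do ! case: ifPn => //; lra.
have : m1 A = 0%E.
  rewrite m13// m3E m2E; suff A0' : leb (A `&` `]-oo, 2^-1[%classic) = 0%E.
    by rewrite [X in (_ * X)%E]A0' mule0.
  apply/eqP; rewrite eq_le measure_ge0 andbT -A0; apply: le_measure; rewrite ?inE//.
  exact: measurableI.
by rewrite m1E.
Qed.

End UnitInterval.

Section RatInf.
Context (R : realType).

(** A generalised inverse over rational thresholds, so that measurability in a parameter needs only
    countable unions. Adding the value [1] keeps the set nonempty, and [0 <= p] bounds it from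
    below. *)
Definition rat_inf (P : rat -> Prop) : R :=
  inf [set s | s = 1 \/ exists p, [/\ 0 <= p, s = ratr p & P p]].

Let rat_inf_lb (P : rat -> Prop) :
  lbound [set s : R | s = 1 \/ exists p, [/\ 0 <= p, s = ratr p & P p]] 0.
Proof. by move=> s [->|[p [p0 -> _]]]; rewrite ?ler01// ler0q. Qed.

Lemma rat_inf_le1 P : rat_inf P <= 1.
Proof. by apply: ge_inf; [exists 0; exact: rat_inf_lb|left]. Qed.

Lemma rat_inf_le P p : 0 <= p -> P p -> rat_inf P <= ratr p.
Proof. by move=> p0 Pp; apply: ge_inf; [exists 0; exact: rat_inf_lb|right; exists p]. Qed.

Lemma rat_inf_lt P s : rat_inf P < s ->
  1 < s \/ exists p, [/\ 0 <= p, ratr p < s & P p].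
Proof.
move=> ts; set I := [set s : R | s = 1 \/ exists p, [/\ 0 <= p, s = ratr p & P p]].
have [||r Ir rs] := @inf_adherent _ I (s - rat_inf P).
- by rewrite subr_gt0.
- by split; [exists 1; left|exists 0; exact: rat_inf_lb].
move: rs; rewrite addrC subrK => rs; case: Ir rs => [->|[p [p0 -> Pp]] ps].
  by left.
by right; exists p.
Qed.

Lemma measurable_rat_inf d (T : measurableType d) (P : T -> rat -> Prop) :
  (forall p, measurable [set x | P x p]) -> measurable_fun setT (fun x => rat_inf (P x)).
Proof.
move=> mP; apply: measurable_fun_rat => q.
have [q1|q1] := ltP (1 : R) (ratr q).
  rewrite (_ : mkset _ = setT)// eqEsubset; split => // x _ /=.
  by apply: le_lt_trans q1; exact: rat_inf_le1.
rewrite (_ : mkset _ = \bigcup_(p in [set p : rat | 0 <= p /\ p < q]) [set x | P x p]).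
  rewrite bigcup_mkcond; apply: countable_bigcupT_measurable => // p.
  by case: ifP.
rewrite eqEsubset; split => x /=.
  move=> /rat_inf_lt[/(le_lt_trans q1)|[p [p0 pq Pp]]]; first by rewrite ltxx.
  by exists p => //=; rewrite -(ltr_rat R).
move=> [p /= [p0 pq] Pp]; apply: (@le_lt_trans _ _ (ratr p)); last by rewrite ltr_rat.
exact: rat_inf_le.
Qed.

End RatInf.

(** * Conditional quantile transform *)

Section Quantile.
Context (R : realType) d1 d2 (T : measurableType d1) (Y : measurableType d2).
Variables (mu : probability T R) (phi : T -> Y) (g : T -> R) (Z : set T).
Hypotheses (mphi : measurable_fun setT phi) (mg : measurable_fun setT g).
Hypotheses (mZ : measurable Z) (g01 : forall x, 0 < g x < 1).
Variable leb : {finite_measure set R -> \bar R}.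
Hypotheses (leb1 : leb setT = 1%E) (lebE : forall r, leb `]-oo, r[%classic = (clamp r)%:E).

Let image_measure (W : set T) : measurable W ->
  exists m : {finite_measure set Y -> \bar R}, forall V, m V = mu (phi @^-1` V `&` W).
Proof.
move=> mW; have [m1 m1E] := exists_restr mu mW.
have [m2 m2E] := exists_pushforward m1 mphi.
have [|m3 m3E] := @exists_finite _ _ _ m2.
  rewrite m2E m1E -ge0_fin_numE// fin_num_measure//.
  by apply: measurableI => //; rewrite preimage_setT.
by exists m3 => V; rewrite m3E m2E m1E.
Qed.

Let subgraph (nu : {finite_measure set Y -> \bar R}) (F : Y -> R) V :
  (forall y, 0 <= F y <= 1) -> measurable V ->
  (nu \x leb)%E [set z | V z.1 /\ z.2 < F z.1] = (\int[nu]_(y in V) (F y)%:E)%E.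
Proof.
move=> F01 mV; rewrite /product_measure1 [RHS]integral_mkcond.
apply: eq_integral => y _; rewrite /= patchE.
case: ifPn; rewrite ?inE ?notin_setE => Vy.
  rewrite (_ : xsection _ _ = `]-oo, F y[%classic).
    by rewrite lebE clamp_id.
  rewrite eqEsubset; split => u; rewrite /xsection/= inE /= !in_itv/=.
    by move=> [].
  by [].
rewrite (_ : xsection _ _ = set0) ?measure0// eqEsubset; split => u //.
by rewrite /xsection/= inE /= => -[].
Qed.

(** Inverse transform sampling, fibre by fibre: [t (y, .)] inverts the conditional distribution
    function of [g] given [phi = y], whose value at each rational is a Radon-Nikodym density. This
    takes the place of a disintegration of [mu] along [phi]. *)
Lemma conditional_quantile :
  exists (nu : {finite_measure set Y -> \bar R}) (t : Y * R -> R),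
  [/\ forall V, nu V = mu (phi @^-1` V `&` Z), measurable_fun setT t,
    forall y u u', u <= u' -> t (y, u) <= t (y, u') &
    forall D, measurable D ->
      (nu \x leb)%E [set z | D (z.1, t z)] =
      mu ([set x | D (phi x, g x)] `&` Z)].
Proof.
have [nu nuE] := image_measure mZ; exists nu.
have mgq (q : rat) : measurable [set x | g x <= ratr q].
  rewrite (_ : mkset _ = g @^-1` `]-oo, ratr q]).
    by rewrite -[_ @^-1` _]setTI; exact: mg.
  by rewrite eqEsubset; split => x; rewrite /= in_itv.
have mphiV V : measurable V -> measurable (phi @^-1` V).
  by move=> mV; rewrite -[_ @^-1` _]setTI; exact: mphi.
have /choice[nuq nuqE] : forall q : rat, exists m : {finite_measure set Y -> \bar R},
    forall V, m V = mu (phi @^-1` V `&` (Z `&` [set x | g x <= ratr q])).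
  by move=> q; apply: image_measure; exact: measurableI.
have nuq_nu q V : measurable V -> (nuq q V <= nu V)%E.
  move=> mV; rewrite nuqE nuE; apply: le_measure; rewrite ?inE.
  - by apply: measurableI; [exact: mphiV|exact: measurableI].
  - by apply: measurableI; [exact: mphiV|].
  - by apply: setIS; exact: subIsetl.
have nuq_mono p q V : p <= q -> measurable V -> (nuq p V <= nuq q V)%E.
  move=> pq mV; rewrite !nuqE; apply: le_measure; rewrite ?inE.
  - by apply: measurableI; [exact: mphiV|exact: measurableI].
  - by apply: measurableI; [exact: mphiV|exact: measurableI].
  - apply: setIS; apply: setIS => x /= /le_trans; apply.
    by rewrite ler_rat.
have /choice[F FP] : forall q, exists F : Y -> R, [/\ measurable_fun setT F,
    forall y, 0 <= F y <= 1 &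
    forall V, measurable V -> nuq q V = (\int[nu]_(y in V) (F y)%:E)%E].
  by move=> q; apply: bounded_density => V mV; exact: nuq_nu.
have mF q : measurable_fun setT (F q) by case: (FP q).
have F01 q y : 0 <= F q y <= 1 by case: (FP q).
have FE q V : measurable V -> nuq q V = (\int[nu]_(y in V) (F q y)%:E)%E.
  by case: (FP q) => _ _; apply.
(* The densities are chosen separately for each rational, so they increase with the threshold only
   off a null set. *)
pose N := \bigcup_(pq : rat * rat)
  (if pq.1 <= pq.2 then [set y | F pq.2 y < F pq.1 y] else set0).
have nN : null_set nu N.
  apply: null_bigcup => -[p q] /=; case: ifPn => [pq|_]; last exact: null_set0.
  apply: density_le => //.
  - by move=> y; have [/andP[]] := F01 p y.
  - by move=> y; have [/andP[]] := F01 q y.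
  - by move=> V mV; rewrite -FE// -ge0_fin_numE// fin_num_measure.
  - by move=> V mV; rewrite -!FE//; exact: nuq_mono.
have FN p q y : ~ N y -> p <= q -> F p y <= F q y.
  move=> Ny pq; rewrite leNgt; apply/negP => qp; apply: Ny.
  by exists (p, q) => //=; rewrite pq.
pose t (z : Y * R) : R := rat_inf R (fun p => z.2 < F p z.1); exists t.
have mIF q : measurable [set z : Y * R | z.2 < F q z.1].
  rewrite (_ : mkset _ = (fun z => F q z.1 - z.2) @^-1` `]0, +oo[).
    rewrite -[_ @^-1` _]setTI; apply: measurable_funB => //.
    exact: measurableT_comp.
  by rewrite eqEsubset; split => z /=; rewrite in_itv/= andbT subr_gt0.
have mt : measurable_fun setT t by exact: measurable_rat_inf.
split => //.
  move=> y u u' uu'; rewrite leNgt; apply/negP => /rat_inf_lt[t1|[p [p0 pt u'F]]].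
    by have := rat_inf_le1 R (fun p => u < F p y); rewrite leNgt t1.
  have : t (y, u) <= ratr p.
    by apply: rat_inf_le => //; exact: le_lt_trans u'F.
  by rewrite leNgt pt.
pose kap : {measure set (Y * R) -> \bar R} := (nu \x leb)%E.
have mT1 : measurable_fun setT (fun z : Y * R => (z.1, t z)).
  exact: measurable_fun_pair.
have mT2 : measurable_fun setT (fun x => (phi x, g x)) by exact: measurable_fun_pair.
have [muZ muZE] := exists_restr mu mZ.
have [m1 m1E] := exists_pushforward kap mT1.
have [m2 m2E] := exists_pushforward muZ mT2.
suff m12 : forall D, measurable D -> m1 D = m2 D.
  by move=> D mD; have := m12 D mD; rewrite m1E m2E muZE.
have kapV V : measurable V -> kap (V `*` setT) = nu V.
  by move=> mV; rewrite /kap/= product_measure1E// [X in (_ * X)%E]leb1 mule1.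
have m2V V p : m2 (V `*` `]-oo, ratr p]) = nuq p V.
  rewrite m2E muZE nuqE; congr (mu _); rewrite eqEsubset; split => x /=.
    by rewrite in_itv/= => -[[]].
  by rewrite in_itv/= => -[? []].
have kapF q V : measurable V -> kap [set z | V z.1 /\ z.2 < F q z.1] = nuq q V.
  by move=> mV; rewrite FE//; exact: subgraph.
have mVF q V : measurable V -> measurable [set z : Y * R | V z.1 /\ z.2 < F q z.1].
  move=> mV; rewrite (_ : mkset _ = (V `*` setT) `&` [set z | z.2 < F q z.1]).
    by apply: measurableI => //; exact: measurableX.
  by rewrite eqEsubset; split => z /= [] // [].

have nuq1 q V : 1 <= ratr q :> R -> nuq q V = nu V.
  move=> q1; rewrite nuqE nuE; congr (mu (_ `&` _)).
  rewrite eqEsubset; split => [x []//|x Zx]; split=> //=.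
  by have /andP[_ /ltW] := g01 x; move/le_trans; apply.
have mpre1 V (J : set R) : measurable V -> measurable J ->
    measurable ((fun z : Y * R => (z.1, t z)) @^-1` (V `*` J)).
  by move=> mV mJ; rewrite -[_ @^-1` _]setTI; apply: mT1 => //; exact: measurableX.
(* For [p < 1] and off [N], [t z < p] gives [z.2 < F q z.1 <= F p z.1] for some [q < p]. Conversely,
   for [0 <= p], [z.2 < F p z.1] gives [t z <= p]. The remaining thresholds are settled by the cap
   at [1] and by [0 < g < 1]. *)
apply: measure_prod_unique_sandwich.
- by rewrite m1E preimage_setT -setXTT kapV// -ge0_fin_numE// fin_num_measure.
- move=> V p mV; rewrite m2V m1E.
  have [p1|p1] := leP (1 : R) (ratr p).
    rewrite nuq1// -kapV//; apply: le_measure; rewrite ?inE.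
    + exact: mpre1.
    + exact: measurableX.
    + by move=> z [].
  rewrite -kapF//.
  have mN : measurable N by case: nN.
  apply: (@le_trans _ _ (kap ([set z | V z.1 /\ z.2 < F p z.1] `|` (N `*` setT)))).
    apply: le_measure; rewrite ?inE.
    + exact: mpre1.
    + by apply: measurableU; [exact: mVF|exact: measurableX].
    + move=> z [/= Vz]; rewrite in_itv/= => /rat_inf_lt[/(lt_trans p1)|[q [q0 qp zF]]].
        by rewrite ltxx.
      have [Nz|Nz] := pselect (N z.1); [by right|left; split=> //].
      by apply: (lt_le_trans zF); apply: FN => //; rewrite -(ler_rat R) ltW.
  rewrite (le_trans (measureU2 _ _ _))//; [exact: mVF|exact: measurableX|].
  have NT : kap (N `*` setT) = 0%E by rewrite kapV//; case: nN.
  by rewrite [X in (_ + X)%E]NT adde0.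
- move=> V p mV; rewrite m2V m1E.
  have [p1|p1] := leP (1 : R) (ratr p).
    rewrite nuq1// -kapV//; apply: le_measure; rewrite ?inE.
    + exact: measurableX.
    + exact: mpre1.
    + move=> z [/= Vz _]; split=> //=; rewrite in_itv/=.
      by apply: le_trans p1; exact: rat_inf_le1.
  have [p0|p0] := leP 0 p.
    rewrite -kapF//; apply: le_measure; rewrite ?inE.
    + exact: mVF.
    + exact: mpre1.
    + move=> z [/= Vz zF]; split=> //=; rewrite in_itv/=.
      exact: rat_inf_le.
  rewrite nuqE (_ : _ `&` _ = set0) ?measure0// eqEsubset; split => x //=.
  move=> [_ [_ gp]]; have /andP[g0 _] := g01 x.
  have := lt_le_trans g0 gp; rewrite ltr0q => /(lt_trans p0).
  by rewrite ltxx.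
Qed.

End Quantile.

(** * Measure-preserving maps inside the components, and null sets *)

Section ConnectednessPreserving.
Context (R : realType) (d : measure_display) (X : measurableType d).
Variables (mu : probability X R) (E : X -> X -> Prop).
Hypotheses (symE : forall x y, E x y -> E y x) (pE : pmp mu E).
Variable f : X -> R.
Hypotheses (mf : measurable_fun setT f) (injf : injective f).
Hypothesis imf : forall A, measurable A -> measurable (f @` A).

Lemma conn_sym x y : conn E x y -> conn E y x.
Proof.
elim => [a b ab|a|a b c _ ba _ cb]; [exact/rt_step/symE|exact: rt_refl|].
exact: rt_trans cb ba.
Qed.

(** With a Borel left inverse [chi] at hand, the image of [C] is the set of [y] with [chi y] in [C]
    and [phi (chi y) = y]. This gives the Borel images that [pmp] asks for. *)
Lemma pmp_image (A : set X) (phi chi : X -> X) :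
  measurable A -> measurable_fun setT phi -> measurable_fun setT chi ->
  (forall x, A x -> chi (phi x) = x) -> (forall x, A x -> conn E x (phi x)) ->
  forall C, measurable C -> C `<=` A -> measurable (phi @` C) /\ mu (phi @` C) = mu C.
Proof.
move=> mA mphi mchi chiK cA.
have mim C : measurable C -> C `<=` A -> measurable (phi @` C).
  move=> mC CA; rewrite (_ : _ @` _ = chi @^-1` C `&` [set y | phi (chi y) = y]).
    apply: measurableI; first by rewrite -[_ @^-1` _]setTI; exact: mchi.
    by apply: (measurable_eqset mf injf) => //; exact: measurableT_comp.
  rewrite eqEsubset; split => [_ [x Cx <-]|y [/= Cy yE]]; last by exists (chi y).
  by split; rewrite /= chiK//; exact: CA.
move=> C mC CA; split; first exact: mim.
apply: (pE mA) => //; first exact: measurable_funTS.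
by move=> x y; rewrite !inE => Ax Ay xy; rewrite -(chiK x Ax) xy chiK.
Qed.

End ConnectednessPreserving.

Section FibreNull.
Context (R : realType) (d : measure_display) (X : measurableType d).
Variables (mu : probability X R) (E : X -> X -> Prop).
Hypotheses (symE : forall x y, E x y -> E y x) (pE : pmp mu E).
Variable f : X -> R.
Hypotheses (mf : measurable_fun setT f) (injf : injective f).
Hypothesis imf : forall A, measurable A -> measurable (f @` A).
Hypothesis f01 : forall x, 0 < f x < 1.

(* If mu Z > 0, every partial section of phi on Z is null, so the conditional
   measures on the fibres are atomless and the conditional quantile transform
   identifies Z with X x [0, 1]; halving the second coordinate is then a
   non-measure-preserving injection inside the fibres. *)
Lemma null_fibre (Z N : set X) (phi : X -> X) :
  measurable Z -> measurable_fun setT phi -> null_set mu N ->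
  (forall x, Z x -> N (phi x)) -> (forall x, Z x -> conn E x (phi x)) ->
  mu Z = 0%E.
Proof.
move=> mZ mphi [mN N0] ZN cZ.
have conn_fibre x y : Z x -> Z y -> phi x = phi y -> conn E x y.
  move=> Zx Zy xy; apply: (rt_trans _ _ _ (phi x)); first exact: cZ.
  by rewrite xy; apply: conn_sym => //; exact: cZ.
have [leb [leb1 lebE leb01]] := exists_uniform R.
have [nu [t [nuE mt t_mono tE]]] := conditional_quantile mu mphi mf mZ f01 leb1 lebE.
pose kap : {measure set (X * R) -> \bar R} := (nu \x leb)%E.
have fK : cancel f (finv f) by exact: finvK.
have mfinv := measurable_finv injf imf.
pose S z := finv f (t z).
have mS : measurable_fun setT S by exact: measurableT_comp.
have kapS W : measurable W -> kap [set z | W (S z)] = mu (W `&` Z).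
  move=> mW; have -> : W `&` Z = [set x | [set z : X * R | W (finv f z.2)] (phi x, f x)] `&` Z.
    by rewrite eqEsubset; split => x /=; rewrite fK.
  rewrite -tE// -[mkset _]setTI.
  apply: (measurableT_comp mfinv measurable_snd) => //.
have mpair (r : R) : measurable_fun setT (fun y : X => (y, r)).
  by apply: measurable_fun_pair => //; exact: measurable_cst.
have mty (r : R) : measurable_fun setT (fun y => t (y, r)).
  exact: (measurableT_comp mt (mpair r)).
(* On this set [phi x] determines [x] through the Borel map [y |-> finv f (t (y, r))], so [phi]
   preserves the measure of the set while sending it into [N]. *)
have section0 (r : R) : mu ([set x | f x = t (phi x, r)] `&` Z) = 0%E.
  set W := _ `&` Z.
  have mW : measurable W.
    apply: measurableI => //; apply: measurable_eqsetR => //.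
    exact: (measurableT_comp (mty r) mphi).
  have [|||mim <-] := @pmp_image _ _ _ _ _ pE f mf injf W phi (fun y => finv f (t (y, r)))
    mW mphi _ _ _ W mW (@subset_refl _ W).
  - exact: (measurableT_comp mfinv (mty r)).
  - by move=> x [/= <- _]; rewrite fK.
  - by move=> x [_ /cZ].
  apply/eqP; rewrite eq_le measure_ge0 andbT -N0; apply: le_measure; rewrite ?inE//.
  by move=> _ [x [_ Zx] <-]; exact: ZN.
(* These are the pairs [(y, u)] that the transform sends into [Z] above [y], and whose value under
   [t (y, .)] is not taken at any rational; by monotonicity this value then determines [u]. *)
pose P := [set z : X * R | [/\ 0 <= z.2 <= 1, Z (S z), f (S z) = t z, phi (S z) = z.1 &
  forall r : rat, t z <> t (z.1, ratr r)]].
pose D0 := [set z : X * R | [/\ Z (finv f z.2), f (finv f z.2) = z.2 & phi (finv f z.2) = z.1]].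
have mfinv2 : measurable_fun setT (fun z : X * R => finv f z.2).
  exact: (measurableT_comp mfinv measurable_snd).
have mD0 : measurable D0.
  rewrite (_ : D0 = (fun z => finv f z.2) @^-1` Z `&`
    ([set z | f (finv f z.2) = z.2] `&` [set z | phi (finv f z.2) = z.1])); last first.
    by rewrite eqEsubset; split => z => [[]|[? []]].
  apply: measurableI; first by rewrite -[_ @^-1` _]setTI; exact: mfinv2.
  apply: measurableI.
    by apply: measurable_eqsetR => //; exact: (measurableT_comp mf mfinv2).
  by apply: (measurable_eqset mf injf) => //; exact: (measurableT_comp mphi mfinv2).
have mtz : measurable_fun setT (fun z : X * R => (z.1, t z)) by exact: measurable_fun_pair.
have mtr (r : R) : measurable_fun setT (fun z : X * R => t (z.1, r)).
  exact: (measurableT_comp (mty r) measurable_fst).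
have nP : null_set kap (~` P).
  pose B0 : set (X * R) := setT `*` (~` `[0, 1]%classic).
  pose B1 : set (X * R) := [set z | (~` D0) (z.1, t z)].
  pose B2 : set (X * R) := \bigcup_(r : rat) [set z | t z = t (z.1, ratr r)].
  have -> : ~` P = B0 `|` (B1 `|` B2).
    rewrite eqEsubset; split => z; last first.
      move=> zB [z01 ZS fS phiS tr]; case: zB => [[_]|[]]; rewrite /B1/=.
      - by rewrite in_itv/= z01.
      - by apply.
      - by move=> [r _ /tr].
    move=> nPz; apply: contrapT => /not_orP[nB0 /not_orP[nB1 nB2]]; apply: nPz.
    have [ZS fS phiS] : D0 (z.1, t z) by apply: contrapT => h; exact: nB1.
    split => //.
      by apply: contrapT => h; apply: nB0; split=> //=; rewrite in_itv.
    by move=> r tr; apply: nB2; exists r.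
  apply: nullU; [|apply: nullU].
  - split; first by apply: measurableX => //; exact: measurableC.
    rewrite /kap/= product_measure1E//; last exact: measurableC.
    by rewrite [X in (_ * X)%E]leb01 mule0.
  - split; first by rewrite -[B1]setTI; apply: mtz => //; exact: measurableC.
    rewrite [LHS]tE; last exact: measurableC.
    rewrite (_ : _ `&` _ = set0) ?measure0// eqEsubset; split => x // -[/= h Zx].
    by apply: h; split; rewrite /= ?fK.
  - apply: null_bigcup => r.
    have mr : measurable [set z : X * R | z.2 = t (z.1, ratr r)].
      by apply: measurable_eqsetR => //; exact: mtr.
    split; first by apply: measurable_eqsetR => //; exact: mtr.
    by rewrite [LHS](tE _ mr) section0.
have mP : measurable P by rewrite -[P]setCK; apply: measurableC; case: nP.
(* The infimum of the rational levels at which [t (phi x, .)] has reached [f x]; it recovers [u]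
   from [S (y, u)] on [P]. *)
pose theta x : R := rat_inf R (fun r => f x <= t (phi x, ratr r)).
have mtheta : measurable_fun setT theta.
  apply: measurable_rat_inf => r.
  have mtp : measurable_fun setT (fun x => t (phi x, ratr r)).
    exact: (measurableT_comp (mty _) mphi).
  rewrite (_ : mkset _ = (fun x => t (phi x, ratr r) - f x) @^-1` `[0, +oo[).
    by rewrite -[_ @^-1` _]setTI; apply: measurable_funB.
  by rewrite eqEsubset; split => x /=; rewrite in_itv/= andbT subr_ge0.
have thetaS z : P z -> theta (S z) = z.2.
  case: z => y u [/= /andP[u0 u1] ZS fS phiS tr].
  apply/eqP; rewrite eq_le; apply/andP; split; rewrite leNgt; apply/negP => h.
    have : u < Num.min (theta (S (y, u))) 1.
      rewrite lt_min h/= lt_neqAle u1 andbT; apply/eqP => uE.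
      by apply: (tr 1); rewrite uE rmorph1.
    move=> /rat_in_itvoo[r]; rewrite in_itv/= lt_min => /and3P[ur rth r1].
    have : theta (S (y, u)) <= ratr r.
      apply: rat_inf_le; last by rewrite phiS fS; apply/t_mono/ltW.
      by rewrite -(ler0q R) ltW// (le_lt_trans u0).
    by rewrite leNgt rth.
  move: h => /rat_inf_lt[/(le_lt_trans u1)|[r [r0 ru]]]; first by rewrite ltxx.
  rewrite phiS fS => h; apply: (tr r); apply/eqP; rewrite eq_le h/=.
  exact/t_mono/ltW.
pose half (z : X * R) := (z.1, z.2 / 2).
have mhalf : measurable_fun setT half.
  by apply: measurable_fun_pair => //; apply: measurable_funM.
have nPh : null_set kap [set z | (~` P) (half z)].
  have mPh : measurable [set z | (~` P) (half z)].
    by rewrite -[mkset _]setTI; apply: mhalf => //; exact: measurableC.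
  split=> //; have [mCP] := nP; rewrite /kap/= /product_measure1 => CP0.
  have mxs : measurable_fun setT (leb \o xsection (~` P)) by exact: measurable_fun_xsection.
  (* Almost every section of the complement of [P] is null for the uniform law, and
     [uniform_half_null] keeps it null after halving. *)
  have ae0 : ae_eq nu setT (leb \o xsection (~` P)) (cst 0%E).
    apply/ae_eq_integral_abs => //; rewrite -[RHS]CP0; apply: eq_integral => y _.
    by rewrite gee0_abs.
  rewrite (ae_eq_integral (cst 0%E)) ?integral0//.
    exact: measurable_fun_xsection.
  case: ae0 => N' [mN' N'0 N'P]; exists N'; split => // y /= h.
  apply: N'P => /= h'; apply: h => _.
  rewrite (_ : xsection _ y = [set u | xsection (~` P) y (u / 2)]).
    by apply: uniform_half_null => //; [exact: measurable_xsection|exact: h'].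
  by rewrite eqEsubset; split => u; rewrite /xsection/= !inE.
pose Theta x := (phi x, theta x).
have mTheta : measurable_fun setT Theta by exact: measurable_fun_pair.
have ThetaS z : P z -> Theta (S z) = z.
  by move=> Pz; rewrite /Theta thetaS//; case: (Pz) => _ _ _ -> _; case: z {Pz}.
pose Z' := [set x | [/\ Z x, P (Theta x), S (Theta x) = x & P (half (Theta x))]].
have mZ' : measurable Z'.
  rewrite (_ : Z' = Z `&` (Theta @^-1` P `&` ([set x | S (Theta x) = x] `&`
    (half \o Theta) @^-1` P))); last first.
    by rewrite eqEsubset; split => z => [[]|[? [? []]]].
  apply: measurableI => //; apply: measurableI.
    by rewrite -[_ @^-1` _]setTI; exact: mTheta.
  apply: measurableI.
    by apply: (measurable_eqset mf injf) => //; exact: measurableT_comp.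
  rewrite -[_ @^-1` _]setTI.
  exact: (measurableT_comp mhalf mTheta).
have muZZ' : (mu Z <= mu Z')%E.
  have nCZ' : mu (~` Z' `&` Z) = 0%E.
    rewrite -kapS; last exact: measurableC.
    suff [] : null_set kap [set z | (~` Z') (S z)] by [].
    apply: null_sub (nullU nP nPh).
      by rewrite -[mkset _]setTI; apply: mS => //; exact: measurableC.
    move=> z /= nZ'; apply: contrapT => /not_orP[/contrapT Pz /contrapT Phz].
    by apply: nZ'; split; rewrite ?ThetaS//; case: Pz.
  apply: (@le_trans _ _ (mu (Z' `|` (~` Z' `&` Z)))).
    apply: le_measure; rewrite ?inE//.
      by apply: measurableU => //; apply: measurableI => //; exact: measurableC.
    by move=> x Zx; have [|] := pselect (Z' x); [left|right].
  apply: (le_trans (measureU2 _ _ _)) => //.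
    by apply: measurableI => //; exact: measurableC.
  by rewrite [X in (_ + X)%E]nCZ' adde0.
(* Halved coordinates are at most [1/2], so [psi] maps [Z'] into [V], while [V] has at most [3/4] of
   the mass of [Z]. Any constant strictly between [1/2] and [1] would serve. *)
pose V := [set x | theta x < 3 / 4].
have mV : measurable V.
  rewrite (_ : V = theta @^-1` `]-oo, 3 / 4[).
    by rewrite -[_ @^-1` _]setTI; exact: mtheta.
  by rewrite eqEsubset; split => x; rewrite /V/= in_itv.
have muV : (mu (V `&` Z) <= (3 / 4)%:E * mu Z)%E.
  rewrite -kapS//.
  apply: (@le_trans _ _ (kap ((setT `*` `]-oo, 3 / 4[%classic) `|` ~` P))).
    apply: le_measure; rewrite ?inE//.
    - by rewrite -[mkset _]setTI; exact: mS.
    - by apply: measurableU; [exact: measurableX|exact: measurableC].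
    - move=> z Vz; have [Pz|] := pselect (P z); [left|by right].
      by split=> //=; rewrite in_itv/= -thetaS.
  apply: (le_trans (measureU2 _ _ _)); [exact: measurableX|exact: measurableC|].
  have nP0 : kap (~` P) = 0%E by case: nP.
  rewrite [X in (_ + X)%E]nP0 adde0 /kap/= product_measure1E//.
  rewrite [X in (_ * X)%E]lebE clamp_id; last by apply/andP; split; lra.
  by rewrite muleC [X in (_ * X)%E]nuE preimage_setT setTI.
pose psi x := S (half (Theta x)).
(* Doubling the coordinate is the left inverse that [pmp_image] requires. *)
pose chi x := S (phi x, 2 * theta x).
have psiZ x : Z' x -> Theta (psi x) = half (Theta x) by move=> [_ _ _]; exact: ThetaS.
have [||||mim muim] := @pmp_image _ _ _ _ _ pE f mf injf Z' psi chi mZ' _ _ _ _ Z' mZ' (@subset_refl _ Z').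
- exact: (measurableT_comp mS (measurableT_comp mhalf mTheta)).
- apply: (measurableT_comp mS); apply: measurable_fun_pair => //.
  exact: measurable_funM.
- move=> x Z'x; rewrite /chi; have := psiZ x Z'x; rewrite /Theta /half /= => -[-> ->].
  by case: Z'x => _ _ SE _; rewrite mulrCA divff ?mulr1// SE.
- move=> x Z'x; case: (Z'x) => Zx _ _ [_ Zpsi _ phipsi _].
  by apply: conn_fibre => //; rewrite phipsi.
have : (mu Z <= (3 / 4)%:E * mu Z)%E.
  apply: le_trans muV; apply: (le_trans muZZ'); rewrite -muim.
  apply: le_measure; rewrite ?inE//; first exact: measurableI.
  move=> _ [x Z'x <-]; split; last by case: Z'x => _ _ _ [].
  have := psiZ x Z'x; rewrite /V/= /Theta /half/= => -[_ ->].
  by have := rat_inf_le1 R (fun r => f x <= t (phi x, ratr r)); rewrite -/(theta x); lra.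
have [r [r0 ->]] := prob_fin mu mZ.
rewrite -EFinM lee_fin => rr; congr (_%:E); lra.
Qed.

End FibreNull.

(** * Mass transport along the edges *)

Section Transport.
Context (R : realType) (d : measure_display) (X : measurableType d).
Variables (mu : probability X R) (E : X -> X -> Prop) (n : nat).
Hypotheses (sX : standard_borel R X) (bE : borel_graph E).
Hypotheses (rE : regular mu E n) (pE : pmp mu E).

(** [G] is stable under the maps: the neighbours of its points then have completely listed
    neighbours themselves, so that edges can be traversed backwards. *)
Definition enumerates (phi : nat -> X -> X) (G : set X) :=
  [/\ forall i, measurable_fun setT (phi i), null_set mu (~` G),
    forall x i, G x -> (i < n)%N -> G (phi i x) /\ E x (phi i x),
    forall x i j, G x -> (i < n)%N -> (j < n)%N -> phi i x = phi j x -> i = j &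
    forall x y, G x -> E x y -> exists2 i, (i < n)%N & y = phi i x].

(** There are countably many words in the maps, and by [null_fibre] each of them pulls the bad set
    back to a null set. What remains are the points all of whose images are good. *)
Lemma closed_neighbour_enumeration : exists phi G, enumerates phi G /\
  forall i N, (i < n)%N -> null_set mu N -> null_set mu (phi i @^-1` N).
Proof.
have [f [mf injf imf f01]] := standard_borel_itv sX.
have symE : forall x y, E x y -> E y x by case: bE.
have [phi [G [mphi nG phiE phi_inj phi_surj]]] := neighbour_enumeration mf injf imf bE rE.
have mpre i N : measurable N -> measurable (phi i @^-1` N).
  by move=> mN; rewrite -[_ @^-1` _]setTI; exact: mphi.
have mG : measurable G by rewrite -[G]setCK; apply: measurableC; case: nG.
have pull i N : (i < n)%N -> null_set mu N -> null_set mu (phi i @^-1` N).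
  move=> ii nN; have [mN _] := nN.
  have mZ : measurable (G `&` phi i @^-1` N) by apply: measurableI => //; exact: mpre.
  apply: (@null_sub _ _ _ mu _ ((G `&` phi i @^-1` N) `|` ~` G)); first exact: mpre.
    by move=> x Nx; have [Gx|] := pselect (G x); [left|right].
  apply: nullU => //; split=> //.
  apply: (null_fibre symE pE mf injf imf f01 mZ (mphi i) nN) => [x []//|x [Gx _]].
  exact/rt_step/phiE.
pose it (s : seq 'I_n) x := foldr (fun i : 'I_n => phi i) x s.
have pull_it s N : null_set mu N -> null_set mu (it s @^-1` N).
  elim: s N => [|i s IH] N nN; first by rewrite preimage_id.
  by apply: (IH (phi i @^-1` N)); exact: pull.
pose G' := [set x | forall s, G (it s x)].
exists phi, G'; split => //; split => //.
- rewrite (_ : ~` G' = \bigcup_s (it s @^-1` (~` G))).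
    by apply: null_bigcup => s; exact: pull_it.
  rewrite eqEsubset; split => x /=; first by move=> /existsNP[s ?]; exists s.
  by move=> [s _ h] /(_ s).
- move=> x i G'x ii; split; last by apply: phiE => //; exact: (G'x [::]).
  (* [foldr] applies the last letter of a word first, so appending [i] amounts to starting from
     [phi i x]. *)
  move=> s; have := G'x (rcons s (Ordinal ii)).
  by rewrite /it foldr_rcons.
- by move=> x i j /(_ [::]); exact: phi_inj.
- by move=> x y /(_ [::]); exact: phi_surj.
Qed.

Variables (phi : nat -> X -> X) (G : set X).
Hypothesis enum : enumerates phi G.

Let mphi i : measurable_fun setT (phi i). Proof. by case: enum. Qed.
Let nG : null_set mu (~` G). Proof. by case: enum. Qed.
Let mG : measurable G.
Proof. by rewrite -[G]setCK; apply: measurableC; case: nG. Qed.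

Let mu_full V : measurable V -> mu V = mu (G `&` V).
Proof.
move=> mV; apply/eqP; rewrite eq_le; apply/andP; split; last first.
  by apply: le_measure; rewrite ?inE//; exact: measurableI.
apply: (@le_trans _ _ (mu ((G `&` V) `|` ~` G))).
  apply: le_measure; rewrite ?inE//.
    by apply: measurableU; [exact: measurableI|exact: measurableC].
  by move=> x Vx; have [Gx|] := pselect (G x); [left|right].
apply: (le_trans (measureU2 _ _ _)); [exact: measurableI|exact: measurableC|].
have [_ nG0] := nG.
by rewrite [X in (_ + X)%E]nG0 adde0.
Qed.

(** Edge [i] at [x] is traversed back by edge [j]. For indices below [n], [phi i] is a bijection
    from [A i j] onto [A j i] with inverse [phi j]. *)
Let A i j := [set x | G x /\ phi j (phi i x) = x].

Let mA i j : measurable (A i j).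
Proof.
have [f [mf injf imf f01]] := standard_borel_itv sX.
apply: (measurableI G [set x | phi j (phi i x) = x]) => //.
by apply: (measurable_eqset mf injf) => //; exact: measurableT_comp.
Qed.

Let mu_back i j V : (i < n)%N -> (j < n)%N -> measurable V ->
  mu (A j i `&` phi j @^-1` V) = mu (A i j `&` V).
Proof.
move=> ii jj mV; have [f [mf injf imf f01]] := standard_borel_itv sX.
have [_ _ GE _ _] := enum.
have [||_ <-] := @pmp_image _ _ _ _ _ pE f mf injf (A i j) (phi i) (phi j)
  (mA i j) (mphi i) (mphi j) _ _ (A i j `&` V) (measurableI _ _ (mA i j) mV) (@subIsetl _ _ _).
- by move=> x [].
- by move=> x [Gx _]; apply: rt_step; have [] := GE x i Gx ii.
congr (mu _); rewrite eqEsubset; split => [y [[Gy yE] Vy]|_ [x [[Gx xE] Vx] <-]].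
  exists (phi j y) => //; split=> //; split; last by rewrite yE.
  by have [] := GE y j Gy jj.
split; last by rewrite /= xE.
by split; [have [] := GE x i Gx ii|rewrite xE].
Qed.

Let mu_split (F : nat -> set X) V :
  (forall j, measurable (F j)) -> measurable V ->
  (forall x, G x -> exists2 j, (j < n)%N & F j x) ->
  (forall x i j, (i < n)%N -> (j < n)%N -> F i x -> F j x -> i = j) ->
  (forall j, F j `<=` G) -> mu V = (\sum_(j < n) mu (F j `&` V))%E.
Proof.
move=> mF mV Fcov Finj FG.
have UE : G `&` V = \big[setU/set0]_(j < n) (F j `&` V).
  rewrite -(bigcup_mkord n (fun j => F j `&` V)) eqEsubset; split => x.
    by move=> [Gx Vx]; have [j jn Fx] := Fcov x Gx; exists j.
  by move=> [j /= jn [Fx Vx]]; split=> //; exact: FG Fx.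
rewrite mu_full// UE measure_bigsetU_ord// => [j|]; first exact: measurableI.
apply/trivIsetP => i j _ _ ij; rewrite eqEsubset; split => // x [[Fi _] [Fj _]].
by case/eqP: ij; apply: val_inj; exact: (Finj x) (ltn_ord i) (ltn_ord j) Fi Fj.
Qed.

(** Double counting of directed edges: each preimage is cut according to the index of the returning
    edge, [mu_back] reverses the pieces, and for fixed [i] the sets [A i j] partition [G]. *)
Lemma mass_transport V : measurable V ->
  (\sum_(j < n) mu (phi j @^-1` V) = n%:R%:E * mu V)%E.
Proof.
move=> mV; have [_ _ GE Ginj Gsurj] := enum.
have symE : forall x y, E x y -> E y x by case: bE.
have back x i : G x -> (i < n)%N -> exists2 j, (j < n)%N & A i j x.
  move=> Gx ii; have [Gi Ei] := GE x i Gx ii.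
  by have [j jj xE] := Gsurj _ _ Gi (symE _ _ Ei); exists j.
have mpre j : measurable (phi j @^-1` V) by rewrite -[_ @^-1` _]setTI; exact: mphi.
transitivity (\sum_(j < n) \sum_(i < n) mu (A j i `&` phi j @^-1` V))%E.
  apply: eq_bigr => j _; apply: mu_split => //.
  - by move=> x Gx; exact: back.
  - move=> x i k ii kk [Gx xi] [_ xk].
    have [Gj _] := GE x j Gx (ltn_ord j).
    by apply: (Ginj (phi j x)) => //; rewrite xi xk.
  - by move=> i x [].
rewrite exchange_big/=.
transitivity (\sum_(i < n) mu V)%E; last first.
  have [r [_ ->]] := prob_fin mu mV.
  by rewrite sumEFin sumr_const card_ord -EFinM mulr_natl.
apply: eq_bigr => i _; rewrite (@mu_split (A i) V) //.
- by apply: eq_bigr => j _; apply: mu_back.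
- by move=> x Gx; exact: back.
- move=> x j k jj kk [Gx xj] [_ xk].
  have [Gi _] := GE x i Gx (ltn_ord i).
  by apply: (Ginj (phi i x)) => //; rewrite xj xk.
- by move=> j x [].
Qed.

Lemma mass_transport_integral (g : X -> \bar R) :
  measurable_fun setT g -> (forall x, 0 <= g x)%E ->
  (\sum_(j < n) \int[mu]_x g (phi j x) = n%:R%:E * \int[mu]_x g x)%E.
Proof.
move=> mg g0.
have /choice[m mE] : forall j, exists m : {measure set X -> \bar R},
    (forall A, m A = mu (phi j @^-1` A)) /\ (\int[mu]_x g (phi j x) = \int[m]_x g x)%E.
  move=> j; unshelve eexists (pushforward mu (phi j)) => //; split=> //.
  by rewrite ge0_integral_pushforward// preimage_setT.
transitivity (\int[msum m n]_x g x)%E.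
  rewrite ge0_integral_measure_sum//; apply: eq_bigr => j _.
  by have [_ ->] := mE j.
have n0 : 0 <= n%:R :> R by [].
rewrite -(ge0_integral_mscale mu measurableT (NngNum n0))//.
apply: eq_measure_integral => V mV _.
apply: etrans (mass_transport mV).
by apply: eq_bigr => j _; have [->] := mE j.
Qed.

End Transport.

(** * Integrals up to null sets *)

Section HasIntegral.
Context (R : realType) (d : measure_display) (X : measurableType d).
Variable mu : probability X R.
Import HBNNSimple.

(** The integral of [u] is a supremum over simple functions below [u]. Multiplying such a function
    by the indicator of [G] keeps its integral and places it below [v]. *)
Let le_integral_ae (G : set X) (u v : X -> \bar R) : null_set mu (~` G) ->
  (forall x, 0 <= u x)%E -> (forall x, 0 <= v x)%E ->
  (forall x, G x -> u x = v x) -> (\int[mu]_x u x <= \int[mu]_x v x)%E.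
Proof.
move=> nG u0 v0 uv; have [mCG CG0] := nG.
have mG : measurable G by rewrite -[G]setCK; exact: measurableC.
rewrite ge0_integralTE// ge_ereal_sup// => _ [h /= hu] <-.
pose k := proj_nnsfun h mG.
have -> : sintegral mu h = sintegral mu k.
  have hE (g : {nnsfun X >-> R}) : sintegral mu g = (\int[mu]_x (g x)%:E)%E.
    by rewrite integral_nnsfun// patch_setT.
  rewrite !hE; apply: ae_eq_integral => //.
  - exact/measurable_EFinP.
  - exact/measurable_EFinP.
  exists (~` G); split => // x /= /not_implyP[_ hk] Gx; apply: hk.
  by rewrite /k/= mindicE mem_set// mulr1.
rewrite ge0_integralTE//; apply: ereal_sup_ubound; exists k => // x.
rewrite /k/= mindicE; have [Gx|Gx] := pselect (G x).
  by rewrite mem_set// mulr1 -uv.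
by rewrite memNset// mulr0.
Qed.

(* No measurability: the operators of the statement are only controlled on a
   conull set. *)
Lemma integral_ae (G : set X) (u v : X -> \bar R) : null_set mu (~` G) ->
  (forall x, G x -> u x = v x) -> (\int[mu]_x u x = \int[mu]_x v x)%E.
Proof.
move=> nG uv; rewrite integralE [RHS]integralE.
by congr (_ - _)%E; apply/eqP; rewrite eq_le; apply/andP; split;
  apply: le_integral_ae nG _ _ _ => // x Gx; rewrite ?funeposE ?funenegE uv.
Qed.

Definition has_int (h : X -> R) (a : R) :=
  mu.-integrable setT (EFin \o h) /\ (\int[mu]_x (h x)%:E = a%:E)%E.

Lemma has_int_measurable h a : has_int h a -> measurable_fun setT h.
Proof. by move=> [/measurable_int/measurable_EFinP]. Qed.

Lemma has_int_fin h : mu.-integrable setT (EFin \o h) -> exists a, has_int h a.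
Proof.
move=> ih; exists (fine (\int[mu]_x (h x)%:E)); split=> //.
by rewrite fineK// integrable_fin_num.
Qed.

Lemma has_int_cst c : has_int (fun=> c) c.
Proof.
split; first exact: finite_measure_integrable_cst.
by rewrite integral_cst// [X in (_ * X)%E](probability_setT mu) mule1.
Qed.

Lemma has_int_indic (B : set X) (b : R) :
  measurable B -> mu B = b%:E -> has_int (fun x => \1_B x) b.
Proof.
move=> mB Bb; split; last by rewrite integral_indic// setIT.
by apply: integrable_indic => //; rewrite Bb ltry.
Qed.

Lemma has_intD h k a b : has_int h a -> has_int k b -> has_int (fun x => h x + k x) (a + b).
Proof.
move=> [ih hE] [ik kE]; split.
  rewrite (_ : _ \o _ = (EFin \o h) \+ (EFin \o k))%E//; exact: integrableD.
by rewrite integralD_EFin// EFinD; congr (_ + _)%E.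
Qed.

Lemma has_intZ c h a : has_int h a -> has_int (fun x => c * h x) (c * a).
Proof.
move=> [ih hE]; split.
  by rewrite (_ : _ \o _ = (fun x => c%:E * (h x)%:E)%E)//; exact: integrableZl.
rewrite (_ : (fun x => _) = (fun x => c%:E * (h x)%:E)%E)//.
by rewrite integralZl// hE.
Qed.

Lemma has_int_le h k a b : has_int h a -> has_int k b -> (forall x, h x <= k x) -> a <= b.
Proof.
move=> [ih hE] [ik kE] hk; rewrite -lee_fin -hE -kE.
by apply: le_integral => // x _; rewrite lee_fin.
Qed.

Lemma has_int_eq h k a : (forall x, h x = k x) -> has_int h a -> has_int k a.
Proof. by move=> /funext ->. Qed.

End HasIntegral.

(** * Rayleigh quotients of the adjacency operator and the Laplacian *)

Section QuadraticForms.
Context (R : realType) (d : measure_display) (X : measurableType d).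
Variables (mu : probability X R) (E : X -> X -> Prop) (n : nat).
Hypotheses (sX : standard_borel R X) (bE : borel_graph E).
Hypotheses (rE : regular mu E n) (pE : pmp mu E).
Variables (phi : nat -> X -> X) (G : set X).
Hypothesis enum : enumerates mu E n phi G.

Let mphi i : measurable_fun setT (phi i). Proof. by case: enum. Qed.
Let nG : null_set mu (~` G). Proof. by case: enum. Qed.
Let mG : measurable G.
Proof. by rewrite -[G]setCK; apply: measurableC; case: nG. Qed.

Let nbhd_bij x : G x -> set_bij `I_n (nbhd E x) (fun i => phi i x).
Proof.
move=> Gx; have [_ _ GE Ginj Gsurj] := enum; split.
- by move=> i /= ii; have [] := GE x i Gx ii.
- by move=> i j; rewrite !inE/= => ii jj; exact: Ginj.
- by move=> y /(Gsurj _ _ Gx)[i ii ->]; exists i.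
Qed.

Lemma sum_nbhd (h : X -> R) x : G x ->
  \sum_(y \in nbhd E x) h y = \sum_(i < n) h (phi i x).
Proof.
move=> Gx; rewrite (reindex_fsbig (fun i => phi i x) `I_n)//; last exact: nbhd_bij.
by rewrite -(fsbig_ord _ n (fun i => h (phi i x))).
Qed.

(** For measurable [h] this is measurable everywhere, whereas [adjT E h x * h x], with which it
    agrees on [G], is uncontrolled elsewhere. *)
Definition pairing (h : X -> R) x := (\sum_(i < n) h (phi i x)) * h x.

Lemma adjT_pairing h x : G x -> adjT E h x * h x = pairing h x.
Proof. by move=> Gx; rewrite /adjT sum_nbhd. Qed.

Lemma lapL_pairing h x : G x -> lapL E h x * h x = n%:R * h x ^+ 2 - pairing h x.
Proof.
move=> Gx; rewrite /lapL mulrBl adjT_pairing// /deg sum_nbhd//.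
by rewrite sumr_const card_ord expr2 mulrA.
Qed.

Lemma has_int_transport h a : (forall x, 0 <= h x) -> has_int mu h a ->
  has_int mu (fun x => \sum_(i < n) h (phi i x)) (n%:R * a).
Proof.
move=> h0 hh; have mh := has_int_measurable hh; have [ih hE] := hh.
have mhi i : measurable_fun setT (fun x => h (phi i x)) by exact: measurableT_comp.
have ms : measurable_fun setT (fun x => \sum_(i < n) h (phi i x)).
  by apply: measurable_sum.
have sE : (\int[mu]_x (\sum_(i < n) h (phi i x))%:E = (n%:R * a)%:E)%E.
  have := mass_transport_integral sX bE pE enum (proj2 (measurable_EFinP _ _) mh).
  rewrite [X in (_ * X)%E]hE -EFinM => <-; last by move=> x; rewrite /= lee_fin.
  under eq_integral do rewrite -sumEFin.
  rewrite ge0_integral_sum// => i; first exact/measurable_EFinP.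
  by move=> x _; rewrite lee_fin.
split=> //; apply/integrableP; split; first exact/measurable_EFinP.
under eq_integral do rewrite gee0_abs ?lee_fin ?sumr_ge0//.
by rewrite sE ltry.
Qed.

(** By [2 |a b| <= a^2 + b^2] the pairing is dominated by half of [sum_i h (phi i x)^2 + n h(x)^2],
    whose integral is [n q] by mass transport. *)
Lemma form_bound h q : L2 mu h -> (\int[mu]_x ((h x ^+ 2)%:E) = q%:E)%E ->
  exists a, [/\ has_int mu (pairing h) a,
    (\int[mu]_x ((adjT E h x * h x)%:E) = a%:E)%E,
    (\int[mu]_x ((lapL E h x * h x)%:E) = (n%:R * q - a)%:E)%E &
    - (n%:R * q) <= a].
Proof.
move=> [mh ih] hq; have h2 : has_int mu (fun x => h x ^+ 2) q by [].
pose B x := 2^-1 * (\sum_(i < n) h (phi i x) ^+ 2 + n%:R * h x ^+ 2).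
have hB : has_int mu B (n%:R * q).
  have -> : n%:R * q = 2^-1 * (n%:R * q + n%:R * q) by field.
  apply: has_intZ; apply: has_intD; last exact: has_intZ.
  by apply: (@has_int_transport (fun x => h x ^+ 2)) => // x; exact: sqr_ge0.
have mp : measurable_fun setT (pairing h).
  apply: measurable_funM => //; apply: measurable_sum => i.
  exact: measurableT_comp.
have pB x : `|pairing h x| <= B x.
  rewrite /pairing /B mulr_suml; apply: (le_trans (ler_norm_sum _ _ _)).
  have -> : n%:R * h x ^+ 2 = \sum_(i < n) h x ^+ 2.
    by rewrite sumr_const card_ord mulr_natl.
  rewrite -big_split/= mulr_sumr; apply: ler_sum => i _.
  rewrite normrM -[h (phi i x) ^+ 2]real_normK ?num_real//.
  rewrite -[h x ^+ 2]real_normK ?num_real//.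
  have := sqr_ge0 (`|h (phi i x)| - `|h x|); rewrite !expr2; nra.
have [a ha] : exists a, has_int mu (pairing h) a.
  apply: has_int_fin; have [iB _] := hB; apply: le_integrable iB => //.
    exact/measurable_EFinP.
  by move=> x _; rewrite /= lee_fin (le_trans (pB x))// ler_norm.
exists a; split => //.
- have [_ <-] := ha; apply: (integral_ae nG) => x Gx.
  by rewrite adjT_pairing.
- have : has_int mu (fun x => n%:R * h x ^+ 2 + (-1) * pairing h x) (n%:R * q + (-1) * a).
    by apply: has_intD; exact: has_intZ.
  rewrite mulN1r => -[_ <-]; apply: (integral_ae nG) => x Gx.
  by rewrite lapL_pairing// mulN1r.
- rewrite -mulN1r; apply: (has_int_le (has_intZ (-1) hB) ha) => x.
  by rewrite mulN1r lerNl (le_trans _ (pB x))// -normrN ler_norm.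
Qed.

Lemma rayleigh_lapL r : rayleigh mu (lapL E) r <-> rayleigh mu (adjT E) (n%:R - r).
Proof.
split=> -[h [L2h [q [q0 [hq hr]]]]]; exists h; split=> //; exists q; split=> //; split=> //.
all: have [a [_ aT aL _]] := form_bound L2h hq.
  by rewrite aT; move: hr; rewrite aL => -[raq]; congr (_%:E); rewrite mulrBl -raq; ring.
by rewrite aL; move: hr; rewrite aT => -[raq]; congr (_%:E); rewrite raq; ring.
Qed.

Lemma rayleigh_adjT_lb r : rayleigh mu (adjT E) r -> - n%:R <= r.
Proof.
move=> [h [L2h [q [q0 [hq hr]]]]]; have [a [_ aT _ aq]] := form_bound L2h hq.
move: hr; rewrite aT => -[aE]; rewrite -(ler_pM2r q0) mulNr.
by rewrite -aE.
Qed.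

(** The offset [c] is left free because three values are used: [0] for a vanishing Rayleigh
    quotient, [1] to exclude independent sets of full measure, and [b] for the bound. *)
Lemma test_function (B : set X) (b c : R) (G1 : set X) :
  measurable B -> mu B = b%:E -> null_set mu (~` G1) ->
  (forall x i, G1 x -> (i < n)%N -> B x -> ~ B (phi i x)) ->
  let h := fun x => \1_B x - c in
  [/\ L2 mu h, (\int[mu]_x ((h x ^+ 2)%:E) = (b - 2 * c * b + c ^+ 2)%:E)%E &
   (\int[mu]_x ((adjT E h x * h x)%:E) = (n%:R * (c ^+ 2 - 2 * c * b))%:E)%E].
Proof.
move=> mB Bb nG1 indB h; have hB := has_int_indic mB Bb.
have sq x : (\1_B x : R) ^+ 2 = \1_B x.
  by rewrite indicE; case: (_ \in _); rewrite /= ?expr1n ?expr0n.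
have h2 : has_int mu (fun x => h x ^+ 2) (b - 2 * c * b + c ^+ 2).
  apply: (@has_int_eq _ _ _ _ (fun x => (\1_B x + (- (2 * c)) * \1_B x) + c ^+ 2)).
    by move=> x; rewrite /h; move: (sq x); rewrite !expr2; lra.
  have -> : b - 2 * c * b + c ^+ 2 = b + (- (2 * c)) * b + c ^+ 2 by ring.
  by apply: has_intD; [apply: has_intD => //; exact: has_intZ|exact: has_int_cst].
have [ih2 h2E] := h2; split=> //.
  split=> //; apply: measurable_funB => //; exact: has_int_measurable hB.
have ind0 x : 0 <= \1_B x :> R by rewrite indicE; exact: ler0n.
have hT := has_int_transport ind0 hB.
have : has_int mu (fun x => ((- c) * (\sum_(i < n) \1_B (phi i x)) + (- (n%:R * c)) * \1_B x) + n%:R * c ^+ 2)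
    (((- c) * (n%:R * b) + (- (n%:R * c)) * b) + n%:R * c ^+ 2).
  by apply: has_intD; [apply: has_intD; exact: has_intZ|exact: has_int_cst].
move=> [_]; rewrite (_ : _ + n%:R * c ^+ 2 = n%:R * (c ^+ 2 - 2 * c * b)); last by ring.
move=> <-; have nGG : null_set mu (~` (G `&` G1)) by rewrite setCI; exact: nullU.
apply: (integral_ae nGG) => x [Gx G1x]; rewrite adjT_pairing//; congr (_%:E).
(* Independence enters here: no point of [B] in [G1] has a neighbour in [B]. *)
have s0 : (\sum_(i < n) \1_B (phi i x)) * \1_B x = 0 :> R.
  rewrite mulr_suml big1// => i _; rewrite !indicE.
  have [Bx|Bx] := pselect (B x); last by rewrite (memNset Bx) mulr0.
  by rewrite (memNset (indB x i G1x (ltn_ord i) Bx)) mul0r.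
rewrite /pairing /h sumrB sumr_const card_ord -[c *+ n]mulr_natl.
move: s0; set s := \sum_(i < n) _; set u := \1_B x; rewrite expr2; lra.
Qed.

Hypothesis pull : forall i N, (i < n)%N -> null_set mu N -> null_set mu (phi i @^-1` N).
Hypothesis n0 : (0 < n)%N.

Let gap (f : X -> R) x k : injective f -> (forall y, ~ E y y) -> G x -> (k <= n)%N ->
  exists2 e, 0 < e & forall i, (i < k)%N -> e <= `|f (phi i x) - f x|.
Proof.
move=> injf irr Gx; elim: k => [|k IH] kn; first by exists 1.
have [e e0 eP] := IH (ltnW kn).
have fk : 0 < `|f (phi k x) - f x|.
  rewrite normr_gt0 subr_eq0; apply/eqP => /injf kx.
  have [_ _ GE _ _] := enum; have [_] := GE x k Gx kn.
  by rewrite kx; exact: irr.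
exists (Num.min e `|f (phi k x) - f x|); first by rewrite lt_min e0.
move=> i; rewrite ltnS leq_eqVlt => /predU1P[->|ik]; rewrite ge_min ?lexx ?orbT//.
by rewrite eP.
Qed.

(** Besides giving [m <= 0], this makes the Rayleigh sets nonempty, as [inf] and [sup] over the
    reals require. The sets [A pq] are independent and countably many cover [G], so one has positive
    measure. *)
Lemma rayleigh_adjT_zero : rayleigh mu (adjT E) 0.
Proof.
have [f [mf injf imf f01]] := standard_borel_itv sX.
have irr : forall y, ~ E y y by case: bE => _ [].
pose J (pq : rat * rat) : set R := `]ratr pq.1, ratr pq.2[%classic.
pose A pq := G `&` (f @^-1` J pq `&` \bigcap_(i in `I_n) ~` (phi i @^-1` (f @^-1` J pq))).
have mJ pq : measurable (f @^-1` J pq) by rewrite -[_ @^-1` _]setTI; apply: mf => //; exact: measurable_itv.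
have mA pq : measurable (A pq).
  apply: measurableI => //; apply: measurableI => //.
  apply: bigcap_measurableType => i _; apply: measurableC.
  by rewrite -[phi i @^-1` _]setTI; apply: mphi => //; exact: mJ.
have GA : G `<=` \bigcup_pq A pq.
  move=> x Gx; have [e e0 eP] := gap injf irr Gx (leqnn n).
  have /rat_in_itvoo[p] : f x - e < f x by rewrite ltrBlDr ltrDl.
  have /rat_in_itvoo[q] : f x < f x + e by rewrite ltrDl.
  rewrite !in_itv/= => /andP[xq qe] /andP[ep px].
  exists (p, q) => //; split=> //; split; first by rewrite /J/= in_itv/= px.
  move=> i /= ii; rewrite /J/= in_itv/= => /andP[pi iq].
  have := eP i ii; rewrite leNgt ltr_norml => /negP; apply.
  by apply/andP; split; lra.
have [pq pos] : exists pq, mu (A pq) != 0%E.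
  apply: contrapT => /forallNP h.
  have nA pq : null_set mu (A pq) by split=> //; apply/eqP/negPn/negP; exact: h.
  have : null_set mu [set: X].
    apply: null_sub (nullU nG (null_bigcup nA)) => // x _.
    by have [/GA|] := pselect (G x); [right|left].
  by move=> [_]; rewrite [LHS](probability_setT mu) => /eqP; rewrite onee_eq0.
have [b [b0 bE']] := prob_fin mu (mA pq).
have bpos : 0 < b by rewrite lt_neqAle b0 andbT eq_sym; move: pos; rewrite bE' eqe.
have [x i Gx ii [_ [_ h]] [_ [Ji _]]|L2h hq hT] := @test_function (A pq) b 0 G (mA pq) bE' nG.
  exact: h Ji.
exists (fun x => \1_(A pq) x - 0); split=> //; exists b; split=> //; split.
  by rewrite hq; congr (_%:E); ring.
by rewrite hT; congr (_%:E); ring.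
Qed.

Let m := mop mu (adjT E).

Let m_lb : lbound (rayleigh mu (adjT E)) (- n%:R).
Proof. by move=> r; exact: rayleigh_adjT_lb. Qed.

Let m_le r : rayleigh mu (adjT E) r -> m <= r.
Proof. by move=> Rr; apply: ge_inf => //; exists (- n%:R). Qed.

Lemma mop_adjT_le0 : m <= 0.
Proof. exact/m_le/rayleigh_adjT_zero. Qed.

Lemma Mop_lapL : Mop mu (lapL E) = n%:R - m.
Proof.
have T0 := rayleigh_adjT_zero.
have L0 : rayleigh mu (lapL E) n%:R by apply/rayleigh_lapL; rewrite subrr.
have Lub : ubound (rayleigh mu (lapL E)) (n%:R - m).
  by move=> r /rayleigh_lapL /m_le; lra.
apply/eqP; rewrite eq_le; apply/andP; split; first by apply: ge_sup => //; exists n%:R.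
suff : n%:R - Mop mu (lapL E) <= m by lra.
apply: lb_le_inf; first by exists 0.
move=> r Tr; have : rayleigh mu (lapL E) (n%:R - r).
  by apply/rayleigh_lapL; rewrite opprB addrC subrK.
have hs : has_sup (rayleigh mu (lapL E)) by split; [exists n%:R|exists (n%:R - m)].
by move=> /(ub_le_sup (proj2 hs)); rewrite -/(Mop mu (lapL E)); lra.
Qed.

Lemma independent_bound (S B : set X) : independent E S -> measurable B ->
  mu.-negligible (symdiff S B) -> (mu B <= (- m / (n%:R - m))%:E)%E.
Proof.
move=> indS mB [N [mN N0 SBN]].
have [b [b0 Bb]] := prob_fin mu mB.
have nr0 : 0 < n%:R :> R by rewrite ltr0n.
have m0 := mop_adjT_le0.
(* [S] and [B] differ inside [N], so points that lie in [N] or have a neighbour there are discarded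
   before the independence of [S] is transferred to [B]. *)
pose G1 := (G `&` ~` N) `&` ~` \bigcup_(i : 'I_n) (phi i @^-1` N).
have nN : null_set mu N by split.
have nG1 : null_set mu (~` G1).
  rewrite /G1 !setCI !setCK; apply: nullU; first exact: nullU.
  by apply: null_bigcup => i; exact: pull.
have BS x : ~ N x -> B x -> S x.
  move=> Nx Bx; apply: contrapT => Sx; apply: Nx; apply: SBN; by right.
have indB x i : G1 x -> (i < n)%N -> B x -> ~ B (phi i x).
  move=> [[Gx Nx] Nphi] ii Bx Bphi.
  have [_ _ GE _ _] := enum; have [_] := GE x i Gx ii.
  apply: indS; first exact: BS.
  by apply: BS => // Ni; apply: Nphi; exists (Ordinal ii).
have b1 : b <= 1 by rewrite -lee_fin -Bb probability_le1.
rewrite Bb lee_fin ler_pdivlMr; last by rewrite subr_gt0 (le_lt_trans m0).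
have [->|bn0] := eqVneq b 0; first by rewrite mul0r oppr_ge0.
(* When [b = 1] the function [1_B - 1] has norm zero, so it admits no Rayleigh quotient; its form
   would be [- n], contradicting the lower bound [- n q] with [q = 0]. *)
have [b1'|b1'] := eqVneq b 1.
  have [L2h hq hT] := test_function 1 mB Bb nG1 indB.
  have [a [_ aT _ aq]] := form_bound L2h hq.
  by move: hT aq; rewrite aT b1' => -[->]; rewrite expr1n; lra.
have blt1 : b < 1 by rewrite lt_neqAle b1'.
have bgt0 : 0 < b by rewrite lt_neqAle eq_sym bn0.
have [L2h hq hT] := test_function b mB Bb nG1 indB.
have q0 : 0 < b * (1 - b) by rewrite mulr_gt0// subr_gt0.
(* At [c = b] the form is [- n b^2] and the squared norm is [b (1 - b)]. *)
have : m <= - (n%:R * b) / (1 - b) :> R.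
  apply: m_le; exists (fun x => \1_B x - b); split=> //; exists (b * (1 - b)).
  split=> //; split; first by rewrite hq; congr (_%:E); ring.
  rewrite hT; congr (_%:E).
  have b1n : 1 - b != 0 by rewrite subr_eq0 eq_sym.
  by field.
rewrite ler_pdivlMr ?subr_gt0//; nra.
Qed.

End QuadraticForms.

Theorem theorem6p2 (R : realType) (dX : measure_display) (X : measurableType dX)
  (mu : probability X R) (E : X -> X -> Prop) (d : nat) :
  standard_borel R X -> borel_graph E -> (0 < d)%N ->
  regular mu E d -> pmp mu E ->
  let b := - mop mu (adjT E) / (d%:R - mop mu (adjT E)) in
  b = 1 - d%:R / Mop mu (lapL E) /\
  (forall S B : set X, independent E S -> measurable B ->
     mu.-negligible (symdiff S B) -> (mu B <= b%:E)%E) /\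
  (indep_number mu E <= b%:E)%E.
Proof.
move=> sX bE d0 rE pE b.
have [phi [G [enum pull]]] := closed_neighbour_enumeration sX bE rE pE.
have bound S B : independent E S -> measurable B ->
    mu.-negligible (symdiff S B) -> (mu B <= b%:E)%E.
  exact: (independent_bound sX bE pE enum pull d0).
split; last first.
  split=> //; apply: ge_ereal_sup => _ [S [B [indS [mB [SB ->]]]]].
  exact: bound indS mB SB.
rewrite /b (Mop_lapL sX bE pE enum).
have := mop_adjT_le0 sX bE pE enum.
have : 0 < d%:R :> R by rewrite ltr0n.
move: (mop mu (adjT E)) => m dr m0.
by field; lra.
Qed.
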